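(* Let $(\mathcal{N},\mathcal{I})$ be a $k$-extendible system on a ground set of size $n$, $c_1,\dots,c_m$ knapsack constraints, $f$ non-negative submodular, $M=\max(\lceil\sqrt{1+2m}\rceil,k)$, $\ell=M+1$, $\varepsilon=\delta\in(0,1/2)$, $p=\max(k,\ell-1)$, and $\beta=2(1-\varepsilon)\frac{1-\ell^{-1}-\varepsilon}{p+1+2m}$. Then DensitySearchSGS$(\mathcal{N},f,\mathcal{I},\ell,\delta,\varepsilon,\beta)$ makes $\tilde O(Mn/\varepsilon)$ oracle calls and $\tilde O(Mmn/\varepsilon)$ arithmetic operations and outputs a feasible solution whose approximation ratio is at most $(1-2\varepsilon)^{-3}\Big(\max\big\{k+\frac{2m+1}{k},\,1+2\sqrt{2m+1}\big\}+2m+2\Big)$. Moreover, when $f$ is non-negative monotone submodular, $\ell\le k+1$ and $\beta=2(1-\varepsilon)\frac{1-\varepsilon}{p+1+2m}$, the approximation ratio improves to $(1-\varepsilon)^{-3}(k+2m+1)$.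
   Context: $\mathcal{N}$ finite, $|\mathcal{N}|=n$; $f$ submodular: $f(X\cup Y)+f(X\cap Y)\le f(X)+f(Y)$; monotone: $f(A)\le f(B)$ for $A\subseteq B$; $f(u\mid S)=f(S\cup\{u\})-f(S)$; $S+u=S\cup\{u\}$. Independence system: non-empty down-closed $\mathcal{I}\subseteq2^{\mathcal{N}}$; $k$-extendible: for all $A\subseteq B\in\mathcal{I}$ and $u\notin B$ with $A+u\in\mathcal{I}$ there is $Y\subseteq B\setminus A$, $|Y|\le k$, with $(B\setminus Y)\cup\{u\}\in\mathcal{I}$. Knapsacks: $c_r(S)=\sum_{u\in S}c_r(u)$, $c_r(u)\ge0$. Problem: maximize $f(S)$ s.t. $S\in\mathcal{I}$, $c_r(S)\le1$ for all $r$; every singleton is feasible; $OPT$ optimal; approximation ratio at most $\alpha$ means $f(S)\ge f(OPT)/\alpha$. Oracle calls are value/independence oracle calls; $\tilde O$ hides polylogarithmic factors. KnapsackSGS$(\mathcal{N},f,\mathcal{I},\ell,\rho,\varepsilon)$: $\ell$ solutions $S^{(j)}=\varnothing$, available set $\mathcal{N}$, $\Delta_f=\max_uf(\{u\})$, $\tau=\Delta_f$. While $\tau>(\varepsilon/n)\Delta_f$: for each pair $(u,j)$ with $u$ currently available, if $S^{(j)}+u\in\mathcal{I}$ and $f(u\mid S^{(j)})\ge\max(\tau,\rho\sum_rc_r(u))$, then (knapsack check) if $c_r(S^{(j)}+u)\le1$ for all $r$, add $u$ to $S^{(j)}$ and make $u$ unavailable; after each pass $\tau\leftarrow(1-\varepsilon)\tau$.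 Output the best (w.r.t. $f$) among the $\ell$ solutions and all singletons. $E=1$ iff the knapsack check ever fails, else $E=0$. DensitySearchSGS$(\mathcal{N},f,\mathcal{I},\ell,\delta,\varepsilon,\beta)$: set $k_\ell=1$, $k_u=\lceil\frac1\delta\log n\rceil$. While $|k_u-k_\ell|>1$: set $k_i=\lceil(k_\ell+k_u)/2\rceil$, $\rho_i=\beta\Delta_f(1+\delta)^{k_i}$, run KnapsackSGS with $\rho_i$ obtaining $S_i$ and indicator $E_i$; if $E_i=0$ set $k_\ell=k_i$, else $k_u=k_i$. Finally run KnapsackSGS with $\rho=\beta\Delta_f(1+\delta)^{k_\ell}$. Return the best of all obtained sets.
   Formalization: The two branches of the binary search are exchanged (E_i=1 sets k_ℓ=k_i, E_i=0 sets k_u=k_i), since the ratio fails for the printed order; the arithmetic-operation bound is stated for m≥1; log is base 2; n,k≥1 are assumed. *)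

(* Defs.v *)
From HB Require Import structures.
From mathcomp Require Export all_boot all_order all_algebra.
From mathcomp Require Export reals exp.

Set Implicit Arguments.
Unset Strict Implicit.
Unset Printing Implicit Defensive.

Import Order.TTheory GRing.Theory Num.Theory.
Local Open Scope ring_scope.

(* A program either runs out of fuel (None) or returns a value together with
   (number of oracle calls, number of arithmetic operations); comparisons,
   roundings and logarithms count as arithmetic operations. *)
Definition prog (A : Type) := option (A * (nat * nat)).

Definition charge (A : Type) (q t : nat) (x : A) : prog A := Some (x, (q, t)).
Definition ret (A : Type) (x : A) : prog A := charge 0 0 x.
Definition oracle (A : Type) (x : A) : prog A := charge 1 0 x.
Definition arith (A : Type) (t : nat) (x : A) : prog A := charge 0 t x.

Definition bind (A B : Type) (P : prog A) (Q : A -> prog B) : prog B :=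
  if P is Some (x, (q, t)) then
    if Q x is Some (y, (q', t')) then Some (y, ((q + q')%N, (t + t')%N))
    else None
  else None.

Notation "'do' x := P 'in' Q" := (bind P (fun x => Q))
  (at level 200, x name, P at level 100, Q at level 200,
   format "'[v' 'do'  x  :=  P  'in' '/' Q ']'").

Fixpoint foldM (A B : Type) (step : B -> A -> prog B) (b : B) (s : seq A)
    : prog B :=
  if s is x :: s' then do b' := step b x in foldM step b' s' else ret b.

Fixpoint while (A : Type) (fuel : nat) (guard : A -> prog bool)
    (body : A -> prog A) (x : A) : prog A :=
  if fuel is fuel'.+1 then
    do b := guard x in
    if b then do y := body x in while fuel' guard body y else ret x
  else None.

Section Problem.
Variables (R : realType) (T : finType).
Implicit Types (f : {set T} -> R) (I : {set {set T}}) (S : {set T}).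

Definition submodular f :=
  forall X Y : {set T}, f (X :|: Y) + f (X :&: Y) <= f X + f Y.

Definition monotone f := forall A B : {set T}, A \subset B -> f A <= f B.

Definition nonnegative f := forall S, 0 <= f S.

Definition independence_system I :=
  I != set0 /\ (forall A B : {set T}, A \subset B -> B \in I -> A \in I).

Definition extendible (k : nat) I :=
  forall (A B : {set T}) (u : T),
    A \subset B -> B \in I -> u \notin B -> u |: A \in I ->
    exists Y : {set T},
      [/\ Y \subset B :\: A, (#|Y| <= k)%N & u |: (B :\: Y) \in I].

Variable m : nat.
Implicit Type c : 'I_m -> T -> R.

Definition knapsack c (r : 'I_m) S : R := \sum_(u in S) c r u.

Definition feasible I c S := S \in I /\ (forall r, knapsack c r S <= 1).

Definition optimal f I c OPT :=
  feasible I c OPT /\ (forall S, feasible I c S -> f S <= f OPT).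

Record instance (k : nat) f I c : Prop := Instance {
  inst_ground : (0 < #|T|)%N;
  inst_indep : independence_system I;
  inst_k : (0 < k)%N;
  inst_ext : extendible k I;
  inst_ge0 : nonnegative f;
  inst_sub : submodular f;
  inst_cost : forall r u, 0 <= c r u;
  inst_single : forall u, feasible I c [set u] }.

Definition approx_ratio_le f I c (alpha : R) S :=
  forall OPT, optimal f I c OPT -> f OPT / alpha <= f S.

End Problem.

Section Algorithms.
Variables (R : realType) (T : finType) (f : {set T} -> R) (I : {set {set T}}).
Variables (m : nat) (c : 'I_m -> T -> R) (l : nat).

(* The maximum is over a nonempty set of nonnegative values. *)
Definition max_singleton : prog R :=
  charge #|T| #|T| (\big[Num.max/0]_(u : T) f [set u]).

Definition better (S S' : {set T}) : prog {set T} :=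
  do a := oracle (f S) in
  do b := oracle (f S') in
  do lt := arith 1 (a < b) in
  ret (if lt then S' else S).

(* Only ever called on nonempty lists. *)
Definition best (s : seq {set T}) : prog {set T} :=
  if s is S0 :: s' then foldM better S0 s' else ret set0.

(* load st j r maintains c_r(S^(j)), so that evaluating c_r(S^(j) + u) takes a
   single addition. *)
Record state := State {
  sol : {ffun 'I_l -> {set T}};
  load : {ffun 'I_l -> {ffun 'I_m -> R}};
  avail : {set T};
  failed : bool }.

Definition init_state : state :=
  State [ffun=> set0] [ffun=> [ffun=> 0]] setT false.

Definition add_to (st : state) (u : T) (j : 'I_l) (ld : {ffun 'I_m -> R})
    : state :=
  State [ffun i => if i == j then u |: sol st i else sol st i]
        [ffun i => if i == j then ld else load st i]
        (avail st :\ u) (failed st).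

Definition set_failed (st : state) : state :=
  State (sol st) (load st) (avail st) true.

Definition try_pair (rho tau : R) (st : state) (uj : T * 'I_l) : prog state :=
  let u := uj.1 in
  let j := uj.2 in
  if u \notin avail st then ret st else
  do ind := oracle (u |: sol st j \in I) in
  if ~~ ind then ret st else
  do a := oracle (f (u |: sol st j)) in
  do b := oracle (f (sol st j)) in
  do gain := arith 1 (a - b) in
  do density := arith m.+1 (rho * \sum_(r < m) c r u) in
  do threshold := arith 1 (Num.max tau density) in
  do large := arith 1 (threshold <= gain) in
  if ~~ large then ret st else
  do ld := arith m [ffun r => load st j r + c r u] in
  do fits := arith m [forall r, ld r <= 1] in
  ret (if fits then add_to st u j ld else set_failed st).

(* "For each pair (u, j)" leaves the order of the pairs free: order i is the
   list of all pairs in the order used by the i-th pass. The result is the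
   output set with the indicator E (true for E = 1). *)
Definition KnapsackSGS (order : nat -> seq (T * 'I_l)) (fuel : nat)
    (rho eps : R) : prog ({set T} * bool) :=
  do Delta := max_singleton in
  do final := while fuel
    (fun x : nat * R * state => arith 3 (eps / #|T|%:R * Delta < x.1.2))
    (fun x => let: (i, tau, st) := x in
      do st' := foldM (try_pair rho tau) st (order i) in
      do tau' := arith 2 ((1 - eps) * tau) in
      ret (i.+1, tau', st'))
    (0%N, Delta, init_state) in
  let st := final.2 in
  do S := best ([seq sol st j | j <- enum 'I_l]
                ++ [seq [set u] | u <- enum T]) in
  ret (S, failed st).

Definition log2 (x : R) : R := ln x / ln 2.

Definition density (beta Delta delta : R) (ki : nat) : prog R :=
  arith (ki + 3) (beta * Delta * (1 + delta) ^+ ki).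

Record search := Search {
  lower : nat;
  upper : nat;
  calls : nat;
  found : seq {set T} }.

(* orders i gives the orders of the passes of the i-th call to KnapsackSGS.

   E = 1 guarantees the value rho / 2, which improves with rho, while the
   guarantee obtained when E = 0 improves as rho decreases: the search
   therefore goes up when E = 1 and down when E = 0. The printed pseudocode has
   the two assignments exchanged, and the approximation guarantee then fails.
   For instance, take m = k = 1, all sets independent, f additive, eps = 1/20,
   181 elements of value 1 and cost 1/60, and 2000 elements of value 99/100 and
   cost 1/2000. Whatever the order of the pairs, every run of the exchanged
   search fills its three solutions with elements of the first kind, so that it
   returns 60 where 1980 is feasible, a ratio of 33 against a claimed 11.62.

   The logarithm is binary: (1 + delta) ^ (log2 n / delta) >= n for
   0 < delta < 1, so that the densities searched reach beta * f(OPT). This is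
   false for the natural logarithm. *)
Definition DensitySearchSGS (orders : nat -> nat -> seq (T * 'I_l))
    (fuel : nat) (delta eps beta : R) : prog {set T} :=
  do Delta := max_singleton in
  do ku := arith 3 `|Num.ceil (delta^-1 * log2 #|T|%:R)|%N in
  do s := while fuel
    (fun s => arith 2 (1 < `|(upper s)%:Z - (lower s)%:Z|)%N)
    (fun s =>
      do ki := arith 2 (uphalf (lower s + upper s)) in
      do rho := density beta Delta delta ki in
      do SE := KnapsackSGS (orders (calls s)) fuel rho eps in
      let found' := SE.1 :: found s in
      ret (if SE.2 then Search ki (upper s) (calls s).+1 found'
           else Search (lower s) ki (calls s).+1 found'))
    (Search 1 ku 0 [::]) in
  do rho := density beta Delta delta (lower s) in
  do SE := KnapsackSGS (orders (calls s)) fuel rho eps in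
  best (SE.1 :: found s).

Definition valid_orders (orders : nat -> nat -> seq (T * 'I_l)) :=
  forall i j, perm_eq (orders i j) (enum {: T * 'I_l}).

End Algorithms.

Definition param_M (R : realType) (m k : nat) : nat :=
  maxn `|Num.ceil (Num.sqrt (1 + 2 * m%:R : R))|%N k.

(* x = O(h log^a h) with constant C; used only for h > 2. *)
Definition softO (R : realType) (C : R) (a : nat) (h : R) (x : nat) :=
  x%:R <= C * h * ln h ^+ a.

(* Main.v *)
Require Import Defs.
From mathcomp Require Import sequences zify ring lra.

Set Implicit Arguments.
Unset Strict Implicit.
Unset Printing Implicit Defensive.

Import Order.TTheory GRing.Theory Num.Theory.
Local Open Scope ring_scope.

(* When no knapsack check fails, a run is analysed by charging, for every
   solution S_j, the elements o of OPT \ S_j to the element whose insertion made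
   o useless for S_j: extendibility discards at most k elements of OPT per
   inserted element outside OPT, while an inserted element of OPT is lost only to
   the other l - 1 solutions.  Each charge costs at most gain / (1 - eps) +
   rho c(o), and what remains below the last threshold is paid for by the best
   singleton.  As the sets OPT + S_j retain (l - 1) f(OPT) in total, or l f(OPT)
   if f is monotone, the output is worth at least
   (1 - eps) / (p + 1) (a f(OPT) - m rho) with a = 1 - 1/l, resp. a = 1.

   When a knapsack check fails, some S_j + u overfills a knapsack at density rho,
   so S_j or {u} is worth rho / 2.

   beta is chosen so that both guarantees give beta f(OPT) / 2 at
   rho = beta f(OPT), and the binary search finds two consecutive powers of
   1 + eps around this density, or runs into an end of the range, where
   max f({u}) <= f(OPT) <= n max f({u}) replaces the missing run. *)

(** * Total correctness of programs with cost budgets *)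

Definition spec (A : Type) (P : prog A) (q t : nat) (Q : A -> Prop) : Prop :=
  exists x q' t', [/\ P = Some (x, (q', t')), (q' <= q)%N, (t' <= t)%N & Q x].

Lemma spec_charge (A : Type) (q t : nat) (x : A) (Q : A -> Prop) :
  Q x -> spec (charge q t x) q t Q.
Proof. by exists x, q, t. Qed.

Lemma spec_bind (A B : Type) (P : prog A) (F : A -> prog B)
    (q1 t1 q2 t2 q t : nat) (Q1 : A -> Prop) (Q : B -> Prop) :
  spec P q1 t1 Q1 -> (forall x, Q1 x -> spec (F x) q2 t2 Q) ->
  (q1 + q2 <= q)%N -> (t1 + t2 <= t)%N -> spec (bind P F) q t Q.
Proof.
move=> [x [qx [tx [-> hqx htx /[swap]/[apply]]]]].
move=> [y [qy [ty [Fy hqy hty Qy]]]] hq ht.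
exists y, (qx + qy)%N, (tx + ty)%N; split=> //.
- by rewrite /bind Fy.
- by apply: leq_trans hq; apply: leq_add.
- by apply: leq_trans ht; apply: leq_add.
Qed.

Lemma spec_charge_bind (A B : Type) (q1 t1 : nat) (x : A) (F : A -> prog B)
    (q t : nat) (Q : B -> Prop) :
  (q1 <= q)%N -> (t1 <= t)%N -> spec (F x) (q - q1) (t - t1) Q ->
  spec (bind (charge q1 t1 x) F) q t Q.
Proof.
move=> hq ht FxP; apply: (@spec_bind _ _ _ _ q1 t1 (q - q1) (t - t1) _ _
  (fun y => y = x)); rewrite ?subnKC //; first exact: spec_charge.
by move=> _ ->.
Qed.

Lemma spec_weaken (A : Type) (P : prog A) (q1 t1 q t : nat)
    (Q1 Q : A -> Prop) :
  spec P q1 t1 Q1 -> (q1 <= q)%N -> (t1 <= t)%N -> (forall x, Q1 x -> Q x) ->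
  spec P q t Q.
Proof.
move=> [x [qx [tx [-> hqx htx Qx]]]] hq ht Q1Q.
by exists x, qx, tx; split; rewrite ?(leq_trans hqx) ?(leq_trans htx) //; auto.
Qed.

Lemma spec_ret (A : Type) (x : A) (q t : nat) (Q : A -> Prop) :
  Q x -> spec (ret x) q t Q.
Proof. by move=> Qx; apply: spec_weaken (spec_charge 0 0 Qx) _ _ _. Qed.

Lemma spec_oracle_bind (A B : Type) (x : A) (F : A -> prog B) (q t : nat)
    (Q : B -> Prop) :
  spec (F x) q t Q -> spec (bind (oracle x) F) q.+1 t Q.
Proof. by move=> FxP; apply: spec_charge_bind; rewrite ?subn0 ?subn1. Qed.

Lemma spec_arith_bind (A B : Type) (t1 : nat) (x : A) (F : A -> prog B)
    (q t : nat) (Q : B -> Prop) :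
  spec (F x) q t Q -> spec (bind (arith t1 x) F) q (t1 + t) Q.
Proof.
by move=> FxP; apply: spec_charge_bind; rewrite ?leq_addr // subn0 addKn.
Qed.

(** The invariant is indexed by the prefix already processed, so that after a pass it covers every
    pair of the list. *)
Lemma spec_foldM (A B : Type) (step : B -> A -> prog B) (s : seq A)
    (q t : nat) (J : seq A -> B -> Prop) (b : B) :
  (forall pre x post b, s = pre ++ x :: post -> J pre b ->
     spec (step b x) q t (J (rcons pre x))) ->
  J [::] b -> spec (foldM step b s) (size s * q) (size s * t) (J s).
Proof.
move=> stepP.
suff gen pre post b' : s = pre ++ post -> J pre b' ->
    spec (foldM step b' post) (size post * q) (size post * t) (J s).
  exact: gen.
elim: post pre b' => [|x post IH] pre b' s_eq Jb' /=.
  by apply: spec_ret; rewrite s_eq cats0.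
apply: (spec_bind (stepP _ _ _ _ s_eq Jb')) => [y Jy||]; rewrite ?mulSn //.
by apply: (IH (rcons pre x)) => //; rewrite s_eq cat_rcons.
Qed.

(** [mu] is the termination variant and bounds the number of iterations. The guard is tested once
    more than the body runs, whence the final [tg] and the strict bound [mu x < fuel]. *)
Lemma spec_while (A : Type) (fuel tg : nat) (g : A -> bool)
    (body : A -> prog A) (q t : nat) (J : A -> Prop) (mu : A -> nat) (x : A) :
  (forall y, J y -> g y ->
     spec (body y) q t (fun z => J z /\ (mu z < mu y)%N)) ->
  J x -> (mu x < fuel)%N ->
  spec (while fuel (fun y => arith tg (g y)) body x)
    (mu x * q) (mu x * (tg + t) + tg) (fun y => J y /\ ~~ g y).
Proof.
move=> bodyP; elim: fuel x => // fuel IH x Jx mux.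
set G := fun y => arith tg (g y).
have -> : while fuel.+1 G body x =
  bind (G x) (fun b => if b then bind (body x) (while fuel G body) else ret x).
  by [].
rewrite addnC; apply: spec_arith_bind.
have [gx|ngx] := boolP (g x); last by apply: spec_ret.
have [y [qy [ty [-> hqy hty [Jy muy]]]]] := bodyP x Jx gx.
have [|z [qz [tz [Wz hqz htz Qz]]]] := IH y Jy; first by lia.
exists z, (qy + qz)%N, (ty + tz)%N; split=> //; first by rewrite /bind Wz.
- have : ((mu y).+1 * q <= mu x * q)%N by rewrite leq_mul.
  by rewrite mulSn; lia.
- have : ((mu y).+1 * (tg + t) <= mu x * (tg + t))%N by rewrite leq_mul.
  lia.
Qed.

Section Best.
Variables (R : realType) (T : finType) (f : {set T} -> R).

Lemma spec_better (S S' : {set T}) :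
  spec (better f S S') 2 1
    (fun B => [/\ (B == S) || (B == S'), f S <= f B & f S' <= f B]).
Proof.
do 2!apply: spec_oracle_bind; apply: spec_arith_bind; apply: spec_ret.
by case: ltP => [/ltW|] h; rewrite !eqxx ?orbT.
Qed.

Lemma spec_best (s : seq {set T}) : s != [::] ->
  spec (best f s) (2 * size s) (size s)
    (fun B => B \in s /\ {in s, forall S, f S <= f B}).
Proof.
case: s => // S0 s _ /=.
pose J (pre : seq {set T}) B :=
  B \in S0 :: pre /\ {in S0 :: pre, forall S, f S <= f B}.
have [||B [q [t [FB hq ht JB]]]] :=
    @spec_foldM _ _ (better f) s 2 1 J S0; last 1 first.
- exists B, q, t; split=> //.
  + by apply: leq_trans hq _; rewrite mulnC leq_mul.
  + by apply: leq_trans ht _; rewrite muln1.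
- move=> pre x _ b _ [b_in b_max].
  apply: spec_weaken (spec_better b x) _ _ _ => // B [BE fb fx]; split.
    by case/orP: BE => /eqP->; rewrite inE mem_rcons inE ?eqxx ?orbT //;
      move: b_in; rewrite inE => /orP[|]-> //; rewrite !orbT.
  move=> S; rewrite inE mem_rcons inE orbCA => /orP[/eqP->//|S_in].
  by apply: le_trans fb; apply: b_max; rewrite inE.
- by split=> [|S]; rewrite inE // => /eqP->.
Qed.

End Best.

Lemma disjoint_setU1 (T : finType) (u : T) (A B : {set T}) :
  [disjoint u |: A & B] = (u \notin B) && [disjoint A & B].
Proof. by rewrite -!setI_eq0 setIUl setU_eq0 setI_eq0 disjoints1. Qed.

(** * Inequalities for submodular functions *)

Section Submodular.
Variables (R : realType) (T : finType) (f : {set T} -> R).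
Implicit Types (A B D O S : {set T}) (u o : T).

Definition marg u S : R := f (u |: S) - f S.

Hypothesis f_sub : submodular f.

(** Submodularity is applied to [u |: A] and [B], which meet exactly in [A] because [u] is outside
    [B]. *)
Lemma marg_anti A B u : A \subset B -> u \notin B -> marg u B <= marg u A.
Proof.
move=> AB uB; have := f_sub (u |: A) B.
have -> : (u |: A) :|: B = u |: B by rewrite -setUA (setUidPr AB).
have -> : (u |: A) :&: B = A.
  rewrite setIUl (setIidPl AB); apply/setUidPr/subsetP => x.
  by rewrite !inE => /andP[/eqP-> /(negP uB)].
by rewrite /marg; lra.
Qed.

Lemma set_card_ind (P : {set T} -> Prop) :
  P set0 -> (forall u D, u \notin D -> P D -> P (u |: D)) -> forall D, P D.
Proof.
move=> P0 PS D; have [n] := ubnP #|D|; elim: n D => // n IH D.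
have [->//|[u uD]] := set_0Vmem D; rewrite (cardsD1 u) uD => hD.
by rewrite -(setD1K uD); apply: PS; rewrite ?setD11 //; apply: IH.
Qed.

Lemma union_le_sum_marg S D : [disjoint S & D] ->
  f (S :|: D) - f S <= \sum_(o in D) marg o S.
Proof.
elim/set_card_ind: D => [|u D uD IH]; first by rewrite setU0 big_set0 subrr.
rewrite disjoint_sym disjoint_setU1 => /andP[uS]; rewrite disjoint_sym => /IH {}IH.
rewrite big_setU1 //= setUCA.
have uSD : u \notin S :|: D by rewrite inE negb_or uS.
by have := marg_anti (subsetUl S D) uSD; rewrite {1}/marg; lra.
Qed.

Hypothesis f_ge0 : nonnegative f.

(** Adding the elements to the empty set bounds [f O] by the sum minus [(#|O| - 1) * f set0]. Since
    [f] need not vanish on [set0], the bound can fail for empty [O]. *)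
Lemma le_sum_singletons O : O != set0 -> f O <= \sum_(u in O) f [set u].
Proof.
rewrite -card_gt0 => O_gt0; have := @union_le_sum_marg set0 O.
rewrite set0U -setI_eq0 set0I eqxx /marg => /(_ isT).
under eq_bigr do rewrite setU0.
rewrite big_split /= sumr_const mulNrn.
have : f set0 *+ 1 <= f set0 *+ #|O| by rewrite ler_wpMn2l.
by rewrite mulr1n; lra.
Qed.

Lemma setU1_le_add S u : f (u |: S) <= f [set u] + f S.
Proof. by have := f_sub [set u] S; have := f_ge0 ([set u] :&: S); lra. Qed.

(** By disjointness, [O :|: F i] and the union of [O] with the other sets meet in [O], so each merge
    costs a single [f O]; the last union has non-negative value. *)
Lemma sum_union_disjoint (J : eqType) (s : seq J) (F : J -> {set T}) O :
  uniq s -> {in s &, forall i j, i != j -> [disjoint F i & F j]} ->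
  ((size s)%:R - 1) * f O <= \sum_(j <- s) f (O :|: F j).
Proof.
move=> s_uniq F_disj.
(* The value of the total union is kept in the induction, since the next merge consumes it. *)
suff: (size s)%:R * f O + f (O :|: \bigcup_(j <- s) F j)
        <= \sum_(j <- s) f (O :|: F j) + f O.
  by have := f_ge0 (O :|: \bigcup_(j <- s) F j); lra.
elim: s s_uniq F_disj => [|i s IH] /=; first by rewrite !big_nil setU0; lra.
move=> /andP[i_s s_uniq] F_disj; rewrite !big_cons -[(size s).+1]addn1 natrD.
have {IH} := IH s_uniq (sub_in2 (fun x => @mem_behead _ (i :: s) x) F_disj).
have := f_sub (O :|: F i) (O :|: \bigcup_(j <- s) F j).
rewrite -setUIr -setUUr.
suff -> : F i :&: \bigcup_(j <- s) F j = set0 by rewrite setU0; lra.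
apply/eqP; rewrite big_distrr /= big1_seq // => j /andP[_ j_s].
apply/eqP; rewrite setI_eq0; apply: F_disj; rewrite ?inE ?eqxx ?j_s ?orbT //.
by apply: contraNneq i_s => ->.
Qed.

End Submodular.

(** * The charging argument along a trace of insertions *)

Section Trace.
Variables (R : realType) (T : finType) (f : {set T} -> R) (I : {set {set T}}).
Variables (l k : nat) (w : T -> R) (eps : R).
Implicit Types (S D O : {set T}) (u o : T) (j : 'I_l).

(* The events [(u, j, tau)] of a run, latest first: [u] was added to the [j]-th
   solution during the pass with threshold [tau]. *)
Notation trace := (seq (T * 'I_l * R)).
Implicit Type tr : trace.

Fixpoint tsol tr j : {set T} :=
  if tr is (u, i, _) :: tr' then
    if j == i then u |: tsol tr' j else tsol tr' j
  else set0.

Fixpoint tused tr : {set T} :=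
  if tr is (u, _, _) :: tr' then u |: tused tr' else set0.

(** [w o] is the weighted cost of [o]: a rejection by the test against the maximum of [tau] and
    [w o] gives this bound with [thr = tau], as the maximum is at most the sum. *)
Definition saturated tr (thr : R) :=
  forall o j, o \notin tused tr -> o |: tsol tr j \in I ->
    marg f o (tsol tr j) - w o <= thr.

(** The saturation clause records what the pass at the preceding threshold [tau / (1 - eps)] left
    behind; in the first pass it holds because no gain exceeds the largest singleton value. *)
Fixpoint trace_ok tr : Prop :=
  if tr is (u, j, tau) :: tr' then
    [/\ trace_ok tr', u \notin tused tr', u |: tsol tr' j \in I,
        0 <= tau <= marg f u (tsol tr' j) & saturated tr' (tau / (1 - eps))]
  else True.

Lemma tsol_sub_used tr j : tsol tr j \subset tused tr.
Proof.
elim: tr => [|[[u i] tau] tr IH] /=; first exact: sub0set.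
by case: eqP => _; [exact: setUS | exact: subset_trans IH (subsetUr _ _)].
Qed.

Lemma tsol_mono pre tr j : tsol tr j \subset tsol (pre ++ tr) j.
Proof.
elim: pre => [|[[u i] tau] pre IH] //=.
by case: eqP => // _; exact: subset_trans IH (subsetUr _ _).
Qed.

Lemma trace_ok_cat pre tr : trace_ok (pre ++ tr) -> trace_ok tr.
Proof. by elim: pre => [|[[u i] tau] pre IH] //= [/IH]. Qed.

Lemma tsol_disjoint tr i j :
  trace_ok tr -> i != j -> [disjoint tsol tr i & tsol tr j].
Proof.
elim: tr => [|[[u a] tau] tr IH] /=; first by rewrite -setI_eq0 set0I.
move=> [/IH {}IH u_unused _ _ _] ij.
have u_sol b : u \notin tsol tr b.
  by apply: contra u_unused; exact: subsetP (tsol_sub_used tr b) u.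
have [ia|_] := eqVneq i a; have [ja|_] := eqVneq j a; last exact: IH.
- by rewrite ia ja eqxx in ij.
- by rewrite disjoint_setU1 u_sol IH.
- by rewrite disjoint_sym disjoint_setU1 u_sol disjoint_sym IH.
Qed.

Lemma tsol_indep tr j : set0 \in I -> trace_ok tr -> tsol tr j \in I.
Proof.
move=> I0; elim: tr => [|[[u i] tau] tr IH] //= [/IH {}IH _ uI _ _].
by case: eqP => [->|].
Qed.

Hypothesis f_sub : submodular f.
Hypothesis I_indep : independence_system I.
Hypothesis I_ext : extendible k I.
Hypothesis eps_lt1 : eps < 1.

(** This is the change of a charged sum at one insertion: old terms only decrease, by diminishing
    returns, and each new one is at most [thr]. *)
Lemma sum_marg_step S S' D D' (thr : R) :
  S \subset S' -> D \subset D' -> [disjoint D' & S'] ->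
  (forall o, o \in D' :\: D -> marg f o S - w o <= thr) ->
  \sum_(o in D') (marg f o S' - w o) <=
    \sum_(o in D) (marg f o S - w o) + #|D' :\: D|%:R * thr.
Proof.
move=> SS' DD' D'S' small.
apply: (@le_trans _ _ (\sum_(o in D') (marg f o S - w o))).
  apply: ler_sum => o oD'; rewrite lerD2r marg_anti //.
  by rewrite (disjointFr D'S' oD').
rewrite (big_setID D) /= (setIidPr DD') lerD2l.
apply: le_trans (ler_sum _ small) _.
by rewrite sumr_const mulr_natl.
Qed.

Variables (O : {set T}) (p : nat).
Hypothesis O_indep : O \in I.
Hypothesis k_le_p : (k <= p)%N.
Hypothesis l_le_p : (l.-1 <= p)%N.

(* [Q j] are the elements of [O] not yet charged for in the [j]-th solution.
   Extendibility is applied to the superset [tsol tr j :|: (O :&: tsol fin j)]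
   of the current solution, so that an element of [O] which is added to the
   [j]-th solution later on is never discarded from [Q j].  Hence an element of
   [O] is charged for at most [l - 1] times, by the other solutions, and any
   other element at most [k] times. *)
Lemma charging fin pre tr : fin = pre ++ tr -> trace_ok fin ->
  exists Q : 'I_l -> {set T},
    [/\ forall j, Q j \subset O :\: tused tr,
        forall j, tsol tr j :|: Q j \in I,
        forall j, (O :&: tsol fin j) :\: tsol tr j \subset Q j
      & \sum_j \sum_(o in O :\: (Q j :|: tsol tr j))
             (marg f o (tsol tr j) - w o)
          <= p%:R / (1 - eps) * \sum_j (f (tsol tr j) - f set0)].
Proof.
have [I_neq0 I_down] := I_indep.
move=> fin_eq fin_ok; elim: tr pre fin_eq => [|[[u j0] tau] tr IH] pre fin_eq.
  exists (fun=> O); split=> [j|j|j|] /=; rewrite ?setD0 ?set0U ?subsetIl //.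
  rewrite [leLHS]big1 => [|j _]; last by rewrite setU0 setDv big_set0.
  by rewrite big1 ?mulr0 // => j _; rewrite subrr.
have [|Q [QO QI QF Qsum]] := IH (rcons pre (u, j0, tau)).
  by rewrite cat_rcons.
have [tr_ok u_unused uI /andP[tau_ge0 tau_le] sat] : trace_ok ((u, j0, tau) :: tr).
  by apply: (@trace_ok_cat pre); rewrite -fin_eq.
set S := tsol tr; set S' := tsol ((u, j0, tau) :: tr).
have S'E j : S' j = if j == j0 then u |: S j else S j by [].
have SS' j : S j \subset S' j by rewrite S'E; case: eqP => // _; exact: subsetUr.
have S'fin j : S' j \subset tsol fin j by rewrite fin_eq tsol_mono.
have u_S j : u \notin S j.
  by apply: contra u_unused; exact: subsetP (tsol_sub_used tr j) u.
have u_fin : u \in tsol fin j0.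
  by apply: (subsetP (S'fin j0)); rewrite S'E eqxx setU11.
have u_Q : u \in O -> u \in Q j0.
  by move=> uO; apply: (subsetP (QF j0)); rewrite !inE u_S uO u_fin.
(* It remains to choose the sets [Z j] to be discarded from [Q j]. Each discard is charged at most
   [tau / (1 - eps)], and [p] discards are paid for by the gain of [u], which is at least [tau]. *)
suff [Z [uZ ZI ZF Zcard]] : exists Z : 'I_l -> {set T},
    [/\ forall j, u \notin Q j :\: Z j,
        forall j, S' j :|: (Q j :\: Z j) \in I,
        forall j, Z j :&: (O :&: tsol fin j) \subset S' j
      & (\sum_j #|(Q j :&: Z j) :\: S' j| <= p)%N].
  exists (fun j => Q j :\: Z j); split=> // [j|j|].
  - apply/subsetP => x xQZ; have := xQZ; rewrite inE => /andP[_ xQ].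
    have := subsetP (QO j) x xQ; rewrite inE => /andP[xu xO].
    rewrite inE /= xO andbT in_setU1 negb_or xu andbT.
    by apply: contraNneq (uZ j) => <-.
  - apply/subsetP => x; rewrite inE => /andP[xS' xF].
    rewrite inE; apply/andP; split.
      by apply: contra xS' => xZ; apply: (subsetP (ZF j)); rewrite inE xZ.
    apply: (subsetP (QF j)); rewrite inE xF andbT.
    by apply: contra xS'; exact: subsetP (SS' j) x.
  rewrite -/S'.
  pose D j := O :\: (Q j :|: S j); pose D' j := O :\: ((Q j :\: Z j) :|: S' j).
  have D'D j : D' j :\: D j \subset (Q j :&: Z j) :\: S' j.
    apply/subsetP => x; rewrite !inE -/(S' j).
    have := subsetP (SS' j) x.
    case: (x \in S' j); case: (x \in S j); case: (x \in Q j);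
      case: (x \in Z j); case: (x \in O) => //= h; by have := h isT.
  have step j : \sum_(o in D' j) (marg f o (S' j) - w o) <=
      \sum_(o in D j) (marg f o (S j) - w o) +
      #|(Q j :&: Z j) :\: S' j|%:R * (tau / (1 - eps)).
    have thr_ge0 : 0 <= tau / (1 - eps) by rewrite divr_ge0 // subr_ge0 ltW.
    apply: le_trans (@sum_marg_step (S j) (S' j) (D j) (D' j)
      (tau / (1 - eps)) (SS' j) _ _ _) _.
    + apply/subsetP => x; rewrite !inE !negb_or => /andP[/andP[xQ xS] xO].
      rewrite xO (negPf xQ) andbF andbT /= S'E; case: eqP => // jj0.
      rewrite !inE negb_or xS andbT; apply: contraNneq xQ => xu.
      by rewrite xu jj0 u_Q // -xu.
    + rewrite -setI_eq0; apply/eqP/setP => x; rewrite !inE.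
      by case: (x \in S' j); rewrite ?orbT ?andbF.
    + move=> o /(subsetP (D'D j)); rewrite !inE => /andP[_ /andP[oQ _]].
      have := subsetP (QO j) o oQ; rewrite inE => /andP[o_unused _].
      apply: sat => //; apply: I_down (QI j).
      by apply/subUsetP; split; [rewrite sub1set inE oQ orbT | exact: subsetUl].
    + by rewrite lerD2l ler_wpM2r // ler_nat subset_leq_card.
  apply: le_trans (ler_sum _ (fun j _ => step j)) _.
  rewrite big_split /= -mulr_suml -natr_sum.
  have sumS' : \sum_j (f (S' j) - f set0) =
      \sum_j (f (S j) - f set0) + marg f u (S j0).
    rewrite (bigD1 j0) //= [in RHS](bigD1 j0) //= S'E eqxx.
    rewrite [X in _ + X = _](eq_bigr (fun j => f (S j) - f set0)); last first.
      by move=> j /negPf jj0; rewrite S'E jj0.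
    by rewrite /marg; ring.
  rewrite sumS' mulrDr; apply: lerD => //.
  rewrite mulrAC -!mulrA; apply: ler_pM; rewrite ?ler0n ?ler_nat //.
    by rewrite mulr_ge0 // invr_ge0 subr_ge0 ltW.
  by rewrite ler_wpM2r // invr_ge0 subr_ge0 ltW.
(* For [u] in [O], [u] leaves every [Q j]. In the [j0]-th solution it reappears in [S' j0], so only
   the other [l - 1] solutions are charged. *)
have [uO|uO] := boolP (u \in O).
  exists (fun=> [set u]); split=> [j|j|j|].
  - by rewrite !inE eqxx.
  - apply: I_down (QI j); rewrite S'E; case: eqP => [->|_].
      rewrite !subUset sub1set inE u_Q // orbT subsetUl /=.
      exact: subset_trans (subsetDl _ _) (subsetUr _ _).
    by apply: setUS; exact: subsetDl.
  - apply/subsetP => x; rewrite !inE => /andP[/eqP-> /andP[_ uj]].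
    have [<-|jj0] := eqVneq j0 j; first by rewrite S'E eqxx setU11.
    by have := disjointFr (tsol_disjoint fin_ok jj0) u_fin; rewrite uj.
  - apply: leq_trans l_le_p.
    rewrite (bigD1 j0) //= S'E eqxx.
    have -> : (Q j0 :&: [set u]) :\: (u |: S j0) = set0.
      by apply/setP => x; rewrite !inE; case: eqP; rewrite ?andbF.
    rewrite cards0 add0n.
    apply: (@leq_trans (\sum_(j < l | j != j0) 1)).
      apply: leq_sum => j _; rewrite -(cards1 u); apply: subset_leq_card.
      by apply/subsetP => x; rewrite !inE => /and3P[].
    by rewrite sum1_card cardC1 card_ord.
(* For [u] outside [O], extendibility yields at most [k] discards [Y], all from [Q j0]. Its premise
   holds because the smaller set together with [u] lies in the final [j0]-th solution. *)
have [||||Y [YB Yk YI]] := @I_ext (S j0 :|: (O :&: tsol fin j0))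
    (S j0 :|: Q j0) u.
- apply/subsetP => x; rewrite !inE => /orP[-> //|xF].
  case: (boolP (x \in S j0)) => //= xS.
  by apply: (subsetP (QF j0)); rewrite !inE xS.
- exact: QI.
- rewrite inE negb_or u_S; apply: contra uO => uQ.
  by have := subsetP (QO j0) u uQ; rewrite inE => /andP[].
- have I0 : set0 \in I.
    by have /set0Pn[B BI] := I_neq0; exact: I_down (sub0set B) BI.
  apply: I_down (tsol_indep j0 I0 fin_ok).
  rewrite !subUset sub1set u_fin subsetIr andbT /=.
  exact: subset_trans (SS' j0) (S'fin j0).
have YS x : x \in Y -> (x \notin S j0) && (x \notin O :&: tsol fin j0).
  by move=> /(subsetP YB); rewrite inE => /andP[]; rewrite inE negb_or.
exists (fun j => if j == j0 then Y else set0); split=> [j|j|j|].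
- rewrite inE negb_and; apply/orP; right; apply: contra uO => uQ.
  by have := subsetP (QO j) u uQ; rewrite inE => /andP[].
- rewrite S'E; case: eqP => [->|_]; last by rewrite setD0.
  apply: I_down YI; rewrite -setUA; apply: setUS; rewrite setDUl.
  apply: setSU; apply/subsetP => x xS; rewrite inE xS andbT.
  by apply: contraL xS => /YS /andP[].
- case: eqP => [->|_]; last by rewrite set0I sub0set.
  apply/subsetP => x; rewrite inE => /andP[/YS/andP[_ /negPf->]] //.
- rewrite (bigD1 j0) //= eqxx big1 => [|j /negPf->]; last first.
    by rewrite setI0 set0D cards0.
  rewrite addn0; apply: leq_trans k_le_p; apply: leq_trans Yk.
  by apply: subset_leq_card; apply/subsetP => x; rewrite !inE => /and3P[].
Qed.

(** The elements still in [Q j] at the end are not yet charged; final saturation bounds each by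
    [thr], and there are at most [#|T|] of them per solution. *)
Lemma charging_bound fin (thr : R) :
  trace_ok fin -> saturated fin thr -> 0 <= thr ->
  \sum_j \sum_(o in O :\: tsol fin j) (marg f o (tsol fin j) - w o) <=
    p%:R / (1 - eps) * \sum_j (f (tsol fin j) - f set0) +
    l%:R * (#|T|%:R * thr).
Proof.
move=> fin_ok sat thr_ge0.
have [Q [QO QI _ Qsum]] := @charging fin [::] fin erefl fin_ok.
have [_ I_down] := I_indep.
set S := tsol fin in Qsum *.
suff step j : \sum_(o in O :\: S j) (marg f o (S j) - w o) <=
    \sum_(o in O :\: (Q j :|: S j)) (marg f o (S j) - w o) + #|T|%:R * thr.
  apply: le_trans (ler_sum _ (fun j _ => step j)) _.
  by rewrite big_split /= lerD // big_const_ord iter_addr_0 [leRHS]mulr_natl.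
rewrite (big_setID (O :\: (Q j :|: S j))) /=.
rewrite (setIidPr _); last by apply/setDS/subsetUr.
rewrite lerD2l; apply: (@le_trans _ _ (\sum_(o in (O :\: S j) :\: (O :\: (Q j :|: S j))) thr)).
  apply: ler_sum => o; rewrite !inE => /andP[h /andP[oS oO]].
  have oQ : o \in Q j by move: h; rewrite oO (negPf oS) orbF andbT negbK.
  have := subsetP (QO j) o oQ; rewrite inE => /andP[o_unused _].
  apply: sat => //; apply: I_down (QI j).
  by apply/subUsetP; split; [rewrite sub1set inE oQ orbT | exact: subsetUl].
by rewrite sumr_const -[leLHS]mulr_natl ler_wpM2r // ler_nat max_card.
Qed.

Hypothesis f_ge0 : nonnegative f.
Hypothesis l_gt0 : (0 < l)%N.
Hypothesis w_ge0 : forall o, 0 <= w o.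
Hypothesis eps_gt0 : 0 < eps.

(* The residual threshold is paid for by a singleton: [Delta <= B]. *)
Lemma trace_value fin (thr Delta B W a : R) :
  trace_ok fin -> saturated fin thr -> 0 <= thr ->
  #|T|%:R * thr * (1 - eps) <= eps * Delta ->
  Delta <= B -> (forall j, f (tsol fin j) <= B) ->
  \sum_(o in O) w o <= W ->
  a * l%:R * f O <= \sum_j f (O :|: tsol fin j) ->
  (1 - eps) / (p%:R + 1) * (a * f O - W) <= B.
Proof.
move=> fin_ok sat thr_ge0 thr_le DeltaB solB wW aO.
have e_gt0 : 0 < 1 - eps by rewrite subr_gt0.
have l_gt0' : 0 < l%:R :> R by rewrite ltr0n.
have cb := charging_bound fin_ok sat thr_ge0.
set S := tsol fin in cb solB aO *.
have union j : f (O :|: S j) - f (S j) <=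
    \sum_(o in O :\: S j) (marg f o (S j) - w o) + W.
  have -> : O :|: S j = S j :|: (O :\: S j).
    by apply/setP => x; rewrite !inE; case: (x \in O); case: (x \in S j).
  have SO : [disjoint S j & O :\: S j].
    by rewrite -setI_eq0 setIDA setDIl setDv set0I.
  rewrite sumrB; have := union_le_sum_marg f_sub SO.
  have : \sum_(o in O :\: S j) w o <= W.
    apply: le_trans wW; rewrite [leRHS](big_setID (S j)) /= lerDr.
    by apply: sumr_ge0.
  by lra.
have solsum : \sum_j f (S j) <= l%:R * B.
  apply: le_trans (ler_sum _ (fun j _ => solB j)) _.
  by rewrite big_const_ord iter_addr_0 mulr_natl.
have : \sum_j (f (O :|: S j) - f (S j)) <=
    \sum_j (\sum_(o in O :\: S j) (marg f o (S j) - w o) + W).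
  by apply: ler_sum => j _; exact: union.
rewrite sumrB big_split /= [X in _ <= _ + X]big_const_ord iter_addr_0 -[W *+ l]mulr_natl.
move: cb; rewrite sumrB [X in _ * (_ - X)]big_const_ord iter_addr_0 -[f set0 *+ l]mulr_natl.
set X := \sum_j f (S j) in solsum *; set Y := \sum_j \sum_(_ in _) _.
set Z := \sum_j f (O :|: S j) in aO *; move=> Y_le Z_le.
(* After multiplication by [1 - eps] the residual term is at most [eps * B]. With the
   [(1 - eps) * B] coming from the solution itself it makes exactly one [B], whence the denominator
   [p + 1]. *)
have {}Y_le : Y * (1 - eps) <= p%:R * X + l%:R * (eps * B).
  apply: (@le_trans _ _ ((p%:R / (1 - eps) * (X - l%:R * f set0) +
    l%:R * (#|T|%:R * thr)) * (1 - eps))); first by rewrite ler_pM2r.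
  rewrite mulrDl mulrAC divfK ?gt_eqF // -[l%:R * _ * _]mulrA lerD //.
    rewrite ler_wpM2l ?ler0n // gerBl.
    by rewrite mulr_ge0 ?ler0n //; exact: f_ge0.
  rewrite ler_wpM2l ?ler0n //; apply: le_trans thr_le _.
  by rewrite ler_pM2l.
have pX : p%:R * X <= p%:R * (l%:R * B) by rewrite ler_wpM2l ?ler0n.
have ZW : (a * l%:R * f O - l%:R * W - l%:R * B) * (1 - eps) <= Y * (1 - eps).
  by rewrite ler_pM2r //; lra.
rewrite mulrAC ler_pdivrMr; last by rewrite ltr_wpDl ?ler0n.
rewrite -(ler_pM2l l_gt0').
suff : l%:R * ((1 - eps) * (a * f O - W)) =
  (a * l%:R * f O - l%:R * W - l%:R * B) * (1 - eps) + l%:R * B * (1 - eps).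
  by move=> ->; nra.
by ring.
Qed.

End Trace.

(** * Invariants and guarantees of one greedy run *)

Section Knapsack.
Variables (R : realType) (T : finType) (f : {set T} -> R) (I : {set {set T}}).
Variables (m k l : nat) (c : 'I_m -> T -> R) (eps : R).
Hypothesis inst : instance k f I c.
Hypothesis eps_gt0 : 0 < eps.
Hypothesis eps_lt1 : eps < 1.
Hypothesis l_gt0 : (0 < l)%N.

Let f_ge0 := inst_ge0 inst.
Let f_sub := inst_sub inst.

Lemma indep_down (A B : {set T}) : A \subset B -> B \in I -> A \in I.
Proof. by have [_] := inst_indep inst; exact. Qed.

Lemma indep0 : set0 \in I.
Proof.
by have [/set0Pn[B BI] _] := inst_indep inst; exact: indep_down (sub0set B) BI.
Qed.

Definition delta_max : R := \big[Num.max/0]_(u : T) f [set u].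

Lemma singleton_le_delta u : f [set u] <= delta_max.
Proof. exact: le_bigmax. Qed.

Lemma delta_le (B : R) : 0 <= B -> (forall u, f [set u] <= B) -> delta_max <= B.
Proof. by move=> B0 fB; apply: bigmax_le. Qed.

Lemma delta_ge0 : 0 <= delta_max.
Proof. exact: bigmax_ge_id. Qed.

Section FixedDensity.
Variable rho : R.
Hypothesis rho_ge0 : 0 <= rho.

Local Notation state := (state R T m l).
Implicit Types (st : state) (o u : T) (j : 'I_l).

Definition wcost u : R := rho * \sum_(r < m) c r u.

Lemma wcost_ge0 u : 0 <= wcost u.
Proof. by rewrite mulr_ge0 ?sumr_ge0 // => r _; exact: inst_cost inst r u. Qed.

Lemma sum_knapsack (S : {set T}) :
  \sum_(u in S) wcost u = rho * \sum_r knapsack c r S.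
Proof. by rewrite -mulr_sumr exchange_big. Qed.

Lemma knapsackU1 (S : {set T}) u r : u \notin S ->
  knapsack c r (u |: S) = knapsack c r S + c r u.
Proof. by move=> uS; rewrite /knapsack big_setU1 //= addrC. Qed.

(** These facts persist after a failed check. [good_dense] reflects the density test at each
    insertion, and [good_failed] keeps a solution and a singleton that are together worth [rho]. *)
Record good st : Prop := Good {
  good_indep : forall j, sol st j \in I;
  good_load : forall j r, load st j r = knapsack c r (sol st j);
  good_fits : forall j r, load st j r <= 1;
  good_dense : forall j, f set0 + \sum_(u in sol st j) wcost u <= f (sol st j);
  good_avail : forall j u, u \in avail st -> u \notin sol st j;
  good_failed : failed st -> exists u j, rho <= f (sol st j) + f [set u] }.

Definition traced st :=
  exists tr, [/\ trace_ok f I wcost eps tr, forall j, sol st j = tsol tr j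
                & avail st = ~: tused tr].

Definition sat_on (s : pred (T * 'I_l)) st (thr : R) :=
  forall o j, s (o, j) -> o \in avail st -> o |: sol st j \in I ->
    marg f o (sol st j) - wcost o <= thr.

(** Adding [u] can only lower the marginals of available elements, and by down-closure it creates no
    new independent candidate. *)
Lemma sat_on_add s st u j ld thr :
  sat_on s st thr -> good st -> sat_on s (add_to st u j ld) thr.
Proof.
move=> sat st_good o i /= soi; rewrite !inE ffunE => /andP[ou oA].
case: eqP => [ij|_]; last exact: sat.
rewrite {i}ij in soi *; move=> oI; have oI' : o |: sol st j \in I.
  by apply: indep_down oI; rewrite setUS // subsetUr.
apply: le_trans (sat o j soi oA oI').
rewrite lerD2r marg_anti ?subsetUr // !inE negb_or ou.
exact: good_avail st_good _ _ oA.
Qed.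

(** Two thresholds coexist within a pass: all pairs are saturated at the preceding one, and the
    pairs in [done] already at [tau]. A failed check may break this, hence the guard on
    [failed st]. *)
Definition pass_inv (tau : R) (done : seq (T * 'I_l)) st :=
  good st /\ (~~ failed st ->
    [/\ traced st, sat_on predT st (tau / (1 - eps))
      & sat_on (mem done) st tau]).

Lemma pass_inv_rcons tau done st o j :
  pass_inv tau done st ->
  (o \in avail st -> o |: sol st j \in I ->
     marg f o (sol st j) - wcost o <= tau) ->
  pass_inv tau (rcons done (o, j)) st.
Proof.
move=> [st_good ok] new; split=> // /ok[tr_st sat1 sat2]; split=> // o' j' /=.
rewrite mem_rcons inE => /orP[/eqP[-> ->]|]; [exact: new | exact: sat2].
Qed.

Lemma spec_try_pair tau done st uj : 0 <= tau -> pass_inv tau done st ->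
  spec (try_pair f I c rho tau st uj) 3 (3 * m + 4)
    (pass_inv tau (rcons done uj)).
Proof.
case: uj => u j tau_ge0 inv; rewrite /try_pair.
lazy beta iota zeta delta [fst snd].
have [st_good ok] := inv.
have [uA|uA] := boolP (u \in avail st); last first.
  by apply: spec_ret; apply: pass_inv_rcons => //; rewrite (negPf uA).
apply: spec_oracle_bind.
have [uI|uI] := boolP (u |: sol st j \in I); last first.
  by apply: spec_ret; apply: pass_inv_rcons => //; rewrite (negPf uI).
have -> : (3 * m + 4 = 1 + (m.+1 + (1 + (1 + (m + (m + 0))))))%N by lia.
do 2!apply: spec_oracle_bind; do 4!apply: spec_arith_bind.
rewrite -/(marg f u (sol st j)) -/(wcost u).
have uS := good_avail st_good j uA.
have w_ge0 := wcost_ge0 u.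
case: ifPn => [|/negPn large].
  rewrite -ltNge => small; apply: spec_ret; apply: pass_inv_rcons => // _ _.
  suff: Num.max tau (wcost u) <= tau + wcost u by lra.
  by rewrite ge_max lerDl w_ge0 lerDr.
do 2!apply: spec_arith_bind; apply: spec_ret.
have := large; rewrite ge_max => /andP[tau_le w_le].
set ld := finfun _.
have ldE r : ld r = knapsack c r (u |: sol st j).
  by rewrite ffunE (good_load st_good) knapsackU1.
clearbody ld.
have dense : f set0 + \sum_(v in u |: sol st j) wcost v <= f (u |: sol st j).
  rewrite big_setU1 //=; have := good_dense st_good j.
  by move: w_le; rewrite /marg; lra.
case: ifP => [/forallP ld_le1|/negbT/forallPn[r]].
  split=> [|/= not_failed].
    split=> [i|i r|i r|i|i v|/=]; rewrite /= ?ffunE ?[sol (add_to _ _ _ _) _]ffunE.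
    - by case: eqP => [->|_] //; exact: good_indep st_good i.
    - by case: eqP => [->|_] //; exact: good_load st_good i r.
    - by case: eqP => // _; exact: good_fits st_good i r.
    - by case: eqP => [->|_] //; exact: good_dense st_good i.
    - rewrite !inE => /andP[vu vA]; have := good_avail st_good i vA.
      by case: eqP => // ->; rewrite !inE negb_or vu.
    - move=> /(good_failed st_good)[v [i hv]]; exists v, i.
      apply: le_trans hv _; rewrite ffunE lerD2r; case: eqP => // ->.
      by move: tau_le; rewrite /marg; lra.
  have [tr_st sat1 sat2] := ok not_failed; split.
  - have [tr [tr_ok solE availE]] := tr_st.
    have saturated_tr : saturated f I wcost tr (tau / (1 - eps)).
      move=> o i o_unused; rewrite -solE => oI.
      by apply: sat1 => //; rewrite availE inE.
    exists ((u, j, tau) :: tr); split=> /= [|i|].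
    + split=> //; rewrite -?solE ?tau_ge0 //.
      by move: uA; rewrite availE inE.
    + by rewrite ffunE -!solE.
    + by rewrite availE; apply/setP => x; rewrite !inE negb_or.
  - exact: sat_on_add.
  - move=> o i; rewrite /= mem_rcons inE => /orP[/eqP[-> ->]|oi].
      by rewrite !inE eqxx.
    exact: (@sat_on_add (mem done)).
(* A load above [1] makes the weighted cost of [u |: sol st j] at least [rho]. By density this
   bounds the value of that set, which is split between [sol st j] and [[set u]]. *)
rewrite -ltNge => full; split=> //.
have [h1 h2 h3 h4 h5 _] := st_good; split=> //= _; exists u, j.
have rho_le : rho <= \sum_(v in u |: sol st j) wcost v.
  rewrite sum_knapsack -[leLHS]mulr1 ler_wpM2l // (bigD1 r) //= -ldE.
  rewrite -[leLHS]addr0; apply: lerD; first exact: ltW.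
  apply: sumr_ge0 => i _; apply: sumr_ge0 => v _; exact: inst_cost inst i v.
have := setU1_le_add f_sub f_ge0 (sol st j) u; have := f_ge0 set0; lra.
Qed.

Variables (p : nat) (order : nat -> seq (T * 'I_l)).
Hypothesis k_le_p : (k <= p)%N.
Hypothesis l_le_p : (l.-1 <= p)%N.
Hypothesis order_perm : forall i, perm_eq (order i) (enum {: T * 'I_l}).

Definition loop_inv (x : nat * R * state) :=
  let: (i, tau, st) := x in
  [/\ tau = (1 - eps) ^+ i * delta_max, good st
    & ~~ failed st -> traced st /\ sat_on predT st (tau / (1 - eps))].

Lemma loop_inv_init : loop_inv (0%N, delta_max, init_state R T m l).
Proof.
split=> /=; first by rewrite expr0 mul1r.
  split=> //= [j|j r|j r|j|j u]; rewrite ?ffunE ?indep0 ?ler01 //.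
  - by rewrite /knapsack big_set0.
  - by rewrite big_set0 addr0.
  - by rewrite in_set0.
move=> _; split.
  by exists [::]; split=> //= [j|]; rewrite ?ffunE ?setC0.
move=> o j _ _ _; rewrite /= ffunE /marg setU0.
(* No pass precedes the first one, but no gain exceeds [delta_max], which is at most the fictitious
   preceding threshold. *)
apply: (@le_trans _ _ delta_max).
  by have := singleton_le_delta o; have := f_ge0 set0; have := wcost_ge0 o; lra.
by rewrite ler_pdivlMr ?subr_gt0 // ler_piMr ?delta_ge0 // gerBl ltW.
Qed.

(* [F j] stands for the [j]-th solution, and [a] is the fraction of [f O] that
   the sets [O :|: F j] retain on average. *)
Definition survives (a : R) (O : {set T}) :=
  forall F : 'I_l -> {set T}, (forall i j, i != j -> [disjoint F i & F j]) ->
    a * l%:R * f O <= \sum_j f (O :|: F j).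

(** Guaranteed by every run, whatever its indicator; the bound by [f set0] serves an empty
    optimum. *)
Definition fallback (S : {set T}) :=
  [/\ feasible I c S, f set0 <= f S & delta_max <= f S].

Definition dense_value (S : {set T}) :=
  forall a O, feasible I c O -> survives a O ->
    (1 - eps) / (p%:R + 1) * (a * f O - rho * m%:R) <= f S.

(** After [P] passes the threshold has dropped to [eps / #|T|%:R * delta_max]. If a check has
    failed, the better of the recorded solution and singleton is worth [rho / 2]; otherwise the
    trace of the run feeds the charging bound. *)
Lemma spec_KnapsackSGS (P fuel : nat) :
  (1 - eps) ^+ P <= eps / #|T|%:R -> (P < fuel)%N ->
  spec (KnapsackSGS f I c order fuel rho eps)
    (#|T| + (P * (#|T| * l * 3) + 2 * (l + #|T|)))
    (#|T| + (P * (3 + (#|T| * l * (3 * m + 4) + 2)) + 3 + (l + #|T|)))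
    (fun SE => fallback SE.1 /\
       (if SE.2 then is_true (rho / 2 <= f SE.1) else dense_value SE.1)).
Proof.
move=> P_large fuelP; rewrite /KnapsackSGS.
have n_gt0 : 0 < #|T|%:R :> R by rewrite ltr0n (inst_ground inst).
have e_gt0 : 0 < 1 - eps by rewrite subr_gt0.
have D_ge0 := delta_ge0.
apply: spec_charge_bind; rewrite ?leq_addr // !addKn -/delta_max.
pose mu (x : nat * R * state) := (P - x.1.1)%N.
apply: (@spec_bind _ _ _ _ _ _ (2 * (l + #|T|)) (l + #|T|)).
- apply: (@spec_while _ fuel 3 (fun x => eps / #|T|%:R * delta_max < x.1.2)
    _ (#|T| * l * 3) (#|T| * l * (3 * m + 4) + 2) loop_inv mu).
  + move=> [[i tau] st] [tauE st_good ok] guard.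
    have {guard} tau_large : eps / #|T|%:R * delta_max < tau := guard.
    cbv beta iota.
    have tau_gt0 : 0 < tau.
      by apply: le_lt_trans tau_large; rewrite mulr_ge0 // divr_ge0 // ltW.
    have iP : (i < P)%N.
      rewrite ltnNge; apply: contraL tau_large => Pi; rewrite -leNgt tauE.
      rewrite ler_wpM2r //; apply: le_trans P_large.
      by apply: ler_wiXn2l => //; [exact: ltW | rewrite gerBl ltW].
    have size_order : size (order i) = (#|T| * l)%N.
      by rewrite (perm_size (order_perm i)) -cardE card_prod card_ord.
    have := @spec_foldM _ _ (try_pair f I c rho tau) (order i) 3 (3 * m + 4)
      (pass_inv tau) st; rewrite size_order => foldP.
    apply: (@spec_bind _ _ _ _ _ _ 0 (2 + 0) _ _ _ _ (foldP _ _)).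
    * by move=> pre x _ st' _; exact: spec_try_pair (ltW tau_gt0).
    * split=> // /ok[tr_st sat]; split=> // o j; rewrite /= in_nil //.
    * move=> st' [st'_good ok'].
      apply: spec_arith_bind.
      apply: spec_ret; split; last by rewrite /mu /= subnS prednK ?subn_gt0.
      split=> //; first by rewrite tauE exprS mulrA.
      move=> /ok'[tr_st' _ sat']; split=> // o j _.
      (* The division by [1 - eps] undoes the update of the threshold, and every pair occurs in
         [order i]. *)
      rewrite mulrAC mulfV ?gt_eqF // mul1r; apply: sat'.
      by rewrite /= (perm_mem (order_perm i)) mem_enum.
    * by rewrite addn0.
    * exact: leqnn.
  + exact: loop_inv_init.
  + by rewrite /mu /= subn0.
- move=> [[i tau] st] [[tauE st_good ok] guard].
  have {guard} tau_small : tau <= eps / #|T|%:R * delta_max.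
    by rewrite leNgt; exact: guard.
  lazy beta iota zeta delta [snd].
  set s := _ ++ _.
  have s_size : size s = (l + #|T|)%N.
    by rewrite size_cat 2!size_map size_enum_ord -cardT.
  have s_neq0 : s != [::] by rewrite -size_eq0 s_size -lt0n addn_gt0 l_gt0.
  have := spec_best f s_neq0; rewrite s_size => bestP.
  apply: (@spec_bind _ _ _ _ _ _ 0 0 _ _ _ _ bestP) => [S||]; last 2 first.
  + by rewrite addn0.
  + by rewrite addn0.
  move=> [S_in S_max]; apply: spec_ret => /=.
  have sol_le j : f (sol st j) <= f S.
    by apply: S_max; rewrite mem_cat map_f ?mem_enum.
  have single_le u : f [set u] <= f S.
    by apply: S_max; rewrite mem_cat orbC map_f ?mem_enum.
  have D_le : delta_max <= f S by apply: delta_le.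
  split.
    split=> //.
      move: S_in; rewrite mem_cat => /orP[] /mapP[x _ ->].
        split=> [|r]; first exact: good_indep st_good x.
        by rewrite -(good_load st_good) (good_fits st_good).
      exact: inst_single inst x.
    apply: le_trans (sol_le (Ordinal l_gt0)).
    apply: le_trans (good_dense st_good _); rewrite lerDl.
    by apply: sumr_ge0 => u _; exact: wcost_ge0.
  case: ifPn => [/(good_failed st_good)[u [j]]|not_failed].
    by have := sol_le j; have := single_le u; lra.
  have [[tr [tr_ok solE availE]] sat] := ok not_failed.
  move=> a O [OI O_fits] aO.
  apply: (trace_value f_sub (inst_indep inst) (inst_ext inst) eps_lt1 OI
    k_le_p l_le_p f_ge0 l_gt0 wcost_ge0 eps_gt0 (fin := tr)
    (thr := tau / (1 - eps)) (Delta := delta_max)) => //.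
  + move=> o j o_unused; rewrite -solE => oI.
    by apply: sat => //; rewrite availE inE.
  + by rewrite tauE divr_ge0 ?mulr_ge0 ?exprn_ge0 // ltW.
  + rewrite -mulrA divfK ?gt_eqF // mulrC -ler_pdivlMr //.
    by apply: le_trans tau_small _; rewrite mulrAC.
  + by move=> j; rewrite -solE.
  + rewrite sum_knapsack ler_wpM2l //.
    apply: le_trans (ler_sum _ (fun r _ => O_fits r)) _.
    by rewrite big_const_ord iter_addr_0.
  + by apply: aO => i' j ij; exact: tsol_disjoint tr_ok ij.
- by rewrite /mu /= subn0.
- by rewrite /mu /= subn0.
Qed.

End FixedDensity.

End Knapsack.

(** * The binary search over densities *)

(** The rounded-up logarithm of the gap is the variant of the search: either part has at most half
    the gap, rounded up. The slack in [lo <= up.+1] admits the initial state [lo = 1], [up = 0] of a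
    one-element ground set. *)
Lemma search_step (lo up : nat) :
  (lo <= up.+1)%N -> (1 < `|up%:Z - lo%:Z|)%N ->
  let mid := uphalf (lo + up) in
  [/\ (lo < mid)%N, (mid < up)%N,
      (up_log 2 (mid - lo) < up_log 2 (up - lo))%N
    & (up_log 2 (up - mid) < up_log 2 (up - lo))%N].
Proof.
move=> lo_le gap mid.
have [w up_eq] : exists w, up = (lo + w.+2)%N.
  by exists (up - lo - 2)%N; lia.
have midE : mid = (lo + w.+1./2.+1)%N.
  by rewrite /mid up_eq addnA addnn uphalfE -addnS halfD odd_double doubleK.
have w_half : (w <= (w.+1./2).*2 <= w.+1)%N by rewrite -divn2 -muln2; lia.
have logE : up_log 2 (up - lo) = (up_log 2 (w.+1./2.+1)).+1.
  by rewrite up_eq addKn up_log2S.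
split; rewrite ?logE ?ltnS midE ?up_eq; first by lia.
- by lia.
- by apply: leq_up_log; lia.
- by apply: leq_up_log; lia.
Qed.

(** At [r = (1 + e) * (b * x)], one grid step above the balance point,
    [(1 - e) / p * (A * x - r * m)] equals [b / 2 * x + e ^+ 2 * (b * x * m) / p]: the value
    [b / 2 * x] survives the overshoot. In use, [p] is the denominator [p + 1] of the dense
    guarantee. *)
Lemma balanced_density (R : realFieldType) (e A a b x r p m : R) :
  0 < e < 1 -> 0 <= A -> A <= a -> 0 < p -> 0 <= m -> 0 <= x -> 0 <= b ->
  b * (p + 2 * m) = 2 * (1 - e) * A -> r <= (1 + e) * (b * x) ->
  b / 2 * x <= (1 - e) / p * (a * x - r * m).
Proof.
move=> /andP[e_gt0 e_lt1] A_ge0 A_le p_gt0 m_ge0 x_ge0 b_ge0 bE r_le.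
rewrite [leRHS]mulrAC ler_pdivlMr //.
apply: (@le_trans _ _ ((1 - e) * (A * x - (1 + e) * (b * x) * m))); last first.
  apply: ler_wpM2l; first by rewrite subr_ge0 ltW.
  by apply: lerB; apply: ler_wpM2r.
have -> : (1 - e) * (A * x - (1 + e) * (b * x) * m) =
    b / 2 * x * p + e ^+ 2 * (b * x * m).
  have -> : (1 - e) * (A * x - (1 + e) * (b * x) * m) =
    2 * (1 - e) * A * x / 2 - (1 - e ^+ 2) * (b * x * m) by field.
  by rewrite -bE; field.
by rewrite lerDl mulr_ge0 ?sqr_ge0 // !mulr_ge0.
Qed.

Section Search.
Variables (R : realType) (T : finType) (f : {set T} -> R) (I : {set {set T}}).
Variables (m k l p : nat) (c : 'I_m -> T -> R) (eps beta : R).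
Hypothesis inst : instance k f I c.
Hypothesis eps_gt0 : 0 < eps.
Hypothesis eps_lt1 : eps < 1.
Hypothesis l_gt0 : (0 < l)%N.
Hypothesis k_le_p : (k <= p)%N.
Hypothesis l_le_p : (l.-1 <= p)%N.
Hypothesis beta_ge0 : 0 <= beta.
Variable orders : nat -> nat -> seq (T * 'I_l).
Hypothesis orders_valid : valid_orders orders.

Local Notation Delta := (delta_max f).

Definition rho_at (i : nat) : R := beta * Delta * (1 + eps) ^+ i.

Lemma rho_at_ge0 i : 0 <= rho_at i.
Proof.
by rewrite !mulr_ge0 ?delta_ge0 // exprn_ge0 // addr_ge0 // ltW.
Qed.

Lemma rho_atS i : rho_at i.+1 = (1 + eps) * rho_at i.
Proof. by rewrite /rho_at exprS; ring. Qed.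

Lemma rho_at_mono i j : (i <= j)%N -> rho_at i <= rho_at j.
Proof.
move=> ij; rewrite ler_wpM2l ?mulr_ge0 ?delta_ge0 //.
by rewrite ler_weXn2l // lerDl ltW.
Qed.

Definition ku : nat := `|Num.ceil (eps^-1 * log2 #|T|%:R : R)|%N.

Definition dense_at i S := dense_value f I l c eps (rho_at i) p S.
Definition full_at i (S : {set T}) := rho_at i / 2 <= f S.

(** Each end of the range has its initial value or is certified by a set found: by a run with a
    failed check at [lower], by a run without one at [upper]. [inv_size] bounds the list handed to
    the last call of [best]. *)
Record search_inv (s : search T) : Prop := SearchInv {
  inv_lower : (0 < lower s)%N;
  inv_order : (lower s <= (upper s).+1)%N;
  inv_upper : (upper s <= ku)%N;
  inv_found : {in found s, forall S, fallback f I c S};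
  inv_full : lower s = 1%N \/ exists2 S, S \in found s & full_at (lower s) S;
  inv_dense : upper s = ku \/ exists2 S, S \in found s & dense_at (upper s) S;
  inv_size : (size (found s) + up_log 2 (upper s - lower s) <= up_log 2 ku)%N }.

(** The certificates pass to the returned set, as it dominates all sets found; the last disjunction
    comes from the final run at [lo]. *)
Definition search_value (S : {set T}) :=
  exists lo up, [/\ (up <= lo.+1)%N, lo = 1%N \/ full_at lo S,
    up = ku \/ dense_at up S & full_at lo S \/ dense_at lo S].

Lemma dense_at_le i (S S' : {set T}) :
  f S <= f S' -> dense_at i S -> dense_at i S'.
Proof. by move=> SS' dS a O OF aO; apply: le_trans SS'; exact: dS. Qed.

Section Run.
Variables P fuel : nat.
Hypothesis P_large : (1 - eps) ^+ P <= eps / #|T|%:R.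
Hypothesis fuelP : (P < fuel)%N.
Hypothesis fuelL : (up_log 2 ku < fuel)%N.

Let qK := (#|T| + (P * (#|T| * l * 3) + 2 * (l + #|T|)))%N.
Let tK :=
  (#|T| + (P * (3 + (#|T| * l * (3 * m + 4) + 2)) + 3 + (l + #|T|)))%N.

Lemma spec_KnapsackSGS_at i j :
  spec (KnapsackSGS f I c (orders j) fuel (rho_at i) eps) qK tK
    (fun SE => fallback f I c SE.1 /\
       (if SE.2 then is_true (full_at i SE.1) else dense_at i SE.1)).
Proof.
exact: (spec_KnapsackSGS inst eps_gt0 eps_lt1 l_gt0 (rho_at_ge0 i) k_le_p
  l_le_p (orders_valid j) P_large fuelP).
Qed.

Lemma spec_DensitySearchSGS :
  spec (DensitySearchSGS f I c orders fuel eps eps beta)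
    (#|T| + (up_log 2 ku * qK + (qK + 2 * (up_log 2 ku).+1)))
    (#|T| + (3 + (up_log 2 ku * (2 + (2 + (ku + 3 + tK))) + 2 +
      (ku + 4 + (tK + (up_log 2 ku).+1)))))
    (fun S => fallback f I c S /\ search_value S).
Proof.
rewrite /DensitySearchSGS.
apply: spec_charge_bind; rewrite ?leq_addr // !addKn -/Delta.
apply: spec_arith_bind; rewrite -/ku.
pose mu (s : search T) := up_log 2 (upper s - lower s).
have mu0 : (mu (Search 1 ku 0 [::]) <= up_log 2 ku)%N.
  by apply: leq_up_log; exact: leq_subr.
apply: (@spec_bind _ _ _ _ _ _ (qK + 2 * (up_log 2 ku).+1)
  (ku + 4 + (tK + (up_log 2 ku).+1))).
- apply: (@spec_while _ fuel 2
    (fun s => 1 < `|(upper s)%:Z - (lower s)%:Z|)%N _ qK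
    (2 + (ku + 3 + tK)) search_inv mu).
  + move=> [lo up i fd] inv gap.
    have [lo_gt0 lo_le up_le fd_ok full dense sz] := inv.
    rewrite /= in lo_gt0 lo_le up_le fd_ok full dense sz.
    have [lo_mid mid_up mulo muup] := search_step lo_le gap.
    cbv beta iota delta [lower upper calls found].
    set mid := uphalf (lo + up) in lo_mid mid_up mulo muup *.
    apply: spec_arith_bind; rewrite -/mid.
    apply: (@spec_charge_bind _ _ 0 (mid + 3)) => //.
      by rewrite -addnA leq_add // (leq_trans (ltnW mid_up)) // leq_addr.
    rewrite -/(rho_at mid).
    apply: (@spec_bind _ _ _ _ _ _ 0 0 _ _ _ _ (spec_KnapsackSGS_at mid i)).
    * move=> [S E] [S_ok SE]; apply: spec_ret.
      cbv beta iota delta [fst snd] in S_ok, SE |- *.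
      have fd_ok' : {in S :: fd, forall S', fallback f I c S'}.
        by move=> S'; rewrite inE => /orP[/eqP->|/fd_ok].
      have keep Q : (exists2 S', S' \in fd & Q S') ->
          exists2 S', S' \in S :: fd & Q S'.
        by move=> [S' S'fd QS']; exists S'; rewrite // inE S'fd orbT.
      case: E SE => SE; split=> //=; split=> //=.
      - exact: leq_ltn_trans lo_mid.
      - by apply: leqW; exact: ltnW.
      - by right; exists S; rewrite // mem_head.
      - by case: dense => [|/keep]; [left | right].
      - by move: sz muup; rewrite /mu /=; lia.
      - by apply: leqW; exact: ltnW.
      - exact: leq_trans (ltnW mid_up) up_le.
      - by case: full => [|/keep]; [left | right].
      - by right; exists S; rewrite // mem_head.
      - by move: sz mulo; rewrite /mu /=; lia.
    * by rewrite addn0 subn0.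
    * by rewrite addn0; lia.
  + by split=> //=; left.
  + exact: leq_ltn_trans mu0 fuelL.
- move=> [lo up i fd] [inv gap].
  have [lo_gt0 lo_le up_le fd_ok full dense sz] := inv.
  rewrite /= in lo_gt0 lo_le up_le fd_ok full dense sz.
  have up_lo : (up <= lo.+1)%N by move: gap => /=; lia.
  cbv beta iota delta [lower upper calls found].
  apply: (@spec_charge_bind _ _ 0 (lo + 3)) => //.
    by lia.
  rewrite -/(rho_at lo).
  apply: (@spec_bind _ _ _ _ _ _ (2 * (up_log 2 ku).+1) (up_log 2 ku).+1
    _ _ _ _ (spec_KnapsackSGS_at lo i)).
  + move=> [S E] [S_ok SE]; cbv beta iota delta [fst snd] in S_ok, SE |- *.
    have sz' : (size (S :: fd) <= (up_log 2 ku).+1)%N.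
      by rewrite ltnS (leq_trans (leq_addr _ _) sz).
    apply: (spec_weaken (@spec_best _ _ f (S :: fd) isT)) => //.
      by rewrite leq_mul2l.
    move=> B [B_in B_max].
    have S_le : f S <= f B by rewrite B_max ?mem_head.
    have fd_le S' : S' \in fd -> f S' <= f B.
      by move=> S'fd; rewrite B_max // inE S'fd orbT.
    split.
      by move: B_in; rewrite inE => /orP[/eqP->|/fd_ok].
    exists lo, up; split=> //.
    * case: full => [|[S' /fd_le le' full']]; [by left | right].
      exact: le_trans le'.
    * case: dense => [|[S' /fd_le le' dense']]; [by left | right].
      exact: dense_at_le dense'.
    * case: E SE => SE; [left | right]; first exact: le_trans S_le.
      exact: dense_at_le SE.
  + by rewrite subn0.
  + by lia.
- by rewrite leq_add2r leq_mul2r mu0 orbT.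
- by rewrite leq_add2r leq_add2r leq_mul2r mu0 orbT.
Qed.

End Run.

(* The value [beta * f O / 2] balances the two guarantees: a run that fills a
   knapsack is worth [rho / 2], any other run [dense_value], which decreases
   with [rho]. *)
Lemma search_value_ratio (a A : R) (O S : {set T}) :
  beta = 2 * (1 - eps) * (A / (p%:R + 1 + 2 * m%:R)) -> 0 <= A -> A <= a ->
  #|T|%:R <= (1 + eps) ^+ ku ->
  feasible I c O -> survives f l a O -> Delta <= f O -> f O <= #|T|%:R * Delta ->
  search_value S -> beta / 2 * f O <= (1 + eps) * f S.
Proof.
move=> betaE A_ge0 A_le ku_large O_feas aO Delta_le O_le.
move=> [lo [up [up_lo lo_full up_dense lo_run]]].
have fO_ge0 : 0 <= f O by exact: inst_ge0 inst O.
have fS_ge0 : 0 <= f S by exact: inst_ge0 inst S.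
have e1_ge0 : 0 <= 1 + eps by rewrite addr_ge0 // ltW.
have bO_ge0 : 0 <= beta * f O by rewrite mulr_ge0.
have dense_ok i : dense_at i S -> rho_at i <= (1 + eps) * (beta * f O) ->
    beta / 2 * f O <= (1 + eps) * f S.
  move=> /(_ a O O_feas aO) dS rho_le.
  apply: (@le_trans _ _ (f S)); last by rewrite ler_peMl // lerDl ltW.
  apply: le_trans dS.
  have p1_gt0 : 0 < p%:R + 1 :> R by rewrite ltr_wpDl ?ler0n.
  apply: (balanced_density _ A_ge0) => //; first by rewrite eps_gt0.
  rewrite betaE -[LHS]mulrA divfK // gt_eqF // ltr_pwDl //.
  by rewrite mulr_ge0 ?ler0n.
(* Without a full-knapsack certificate at [lo], the final run is dense and [lo] still has its
   initial value. *)
have [full|] : full_at lo S \/ (dense_at lo S /\ lo = 1%N).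
  by case: lo_run; case: lo_full; auto.
have full_ok : beta * f O <= (1 + eps) * rho_at lo ->
    beta / 2 * f O <= (1 + eps) * f S.
  move=> h; apply: le_trans (ler_wpM2l e1_ge0 full).
  by rewrite mulrAC mulrA ler_wpM2r // invr_ge0.
have up_le : rho_at up <= (1 + eps) * rho_at lo.
  by rewrite -rho_atS rho_at_mono.
(* At the top of the range [rho_at ku] is at least [beta * n * Delta], hence at least [beta * f O],
   and [lo] is at most one factor [1 + eps] below. *)
case: up_dense => [upE|/dense_ok up_ok].
  apply: full_ok; apply: le_trans up_le; rewrite upE /rho_at -mulrA.
  rewrite ler_wpM2l //; apply: le_trans O_le _.
  by rewrite mulrC ler_wpM2l // delta_ge0.
(* Either the density at [up] is low enough for the dense guarantee, or the one at [lo] is high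
   enough for the other guarantee. *)
have [/up_ok //|/ltW h] := leP (rho_at up) ((1 + eps) * (beta * f O)).
  apply: full_ok; apply: le_trans up_le; apply: le_trans h.
  by rewrite ler_peMl // lerDl ltW.
(* At [lo = 1] the density is [(1 + eps) * beta * Delta], within the tolerance since
   [Delta <= f O]. *)
move=> [/dense_ok lo_ok lo1]; apply: lo_ok; rewrite lo1 rho_atS /rho_at expr0.
by rewrite mulr1 ler_wpM2l ?ler_wpM2l // addr_ge0 // ltW.
Qed.

End Search.

(** * Logarithmic bounds for passes and search rounds *)

Section Logarithms.
Variable R : realType.
Implicit Types (x e h : R) (n : nat).

Lemma absz_ceil_ge x : 0 <= x -> x <= `|Num.ceil x|%N%:R.
Proof.
move=> x_ge0; rewrite natr_absz ger0_norm ?ceil_ge //.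
by rewrite ceil_ge0 (lt_le_trans _ x_ge0) // ltrN10.
Qed.

Lemma absz_ceil_lt x : 0 <= x -> `|Num.ceil x|%N%:R < x + 1.
Proof.
move=> x_ge0; rewrite natr_absz ger0_norm; last first.
  by rewrite ceil_ge0 (lt_le_trans _ x_ge0) // ltrN10.
by have := ceilB1_lt x; rewrite rmorphB /= ltrBlDr.
Qed.

Lemma ln2_ge_half : 1 / 2 <= ln 2 :> R.
Proof.
rewrite -ler_expR lnK ?posrE // -lef_pV2 ?posrE ?expR_gt0 // -expRN.
by apply: le_trans (expR_ge1Dx _); lra.
Qed.

(* Convexity of the exponential, from its tangent at [e * ln 2]. *)
Lemma expR_ln2_le e : 0 <= e <= 1 -> expR (e * ln 2) <= 1 + e.
Proof.
move=> /andP[e_ge0 e_le1]; set y := e * ln 2.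
have t0 : (1 - e) * (1 - y) <= (1 - e) * expR (- y).
  by rewrite ler_wpM2l ?subr_ge0 // expR_ge1Dx.
have t1 : e * (1 + (ln 2 - y)) <= e * expR (ln 2 - y).
  by rewrite ler_wpM2l // expR_ge1Dx.
have : 1 <= (1 + e) * expR (- y).
  move: t1; rewrite expRD lnK ?posrE // => t1.
  by move: t0 t1; rewrite /y; lra.
by rewrite expRN ler_pdivlMr ?expR_gt0 // mul1r.
Qed.

(** As [2 ^ e <= 1 + e] on the unit interval, [(1 + e) ^ ku] is at least [2 ^ (e * ku)], hence at
    least [n]. *)
Lemma natr_le_expn_ku (T : finType) e : 0 < e <= 1 -> (0 < #|T|)%N ->
  #|T|%:R <= (1 + e) ^+ ku T e.
Proof.
move=> /andP[e_gt0 e_le1] n_gt0.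
have n_ge1 : 1 <= #|T|%:R :> R by rewrite ler1n.
have ln2_gt0 : 0 < ln 2 :> R by rewrite ln_gt0 // ltr1n.
have arg_ge0 : 0 <= e^-1 * log2 #|T|%:R :> R.
  apply: mulr_ge0; first by rewrite invr_ge0 ltW.
  by apply: divr_ge0; [exact: ln_ge0 | exact: ltW].
have := absz_ceil_ge arg_ge0; rewrite -/(ku T e).
rewrite mulrC ler_pdivrMr // /log2 ler_pdivrMr // => ku_ge.
apply: (@le_trans _ _ (expR (e * ln 2) ^+ ku T e)); last first.
  by rewrite lerXn2r ?nnegrE ?expR_ge0 ?addr_ge0 ?expR_ln2_le // ltW.
rewrite -expRM_natl -[leLHS](lnK (_ : _ \in Num.pos)) ?posrE ?ltr0n //.
by rewrite ler_expR mulrA.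
Qed.

(** Since [1 - e <= expR (- e)], this many factors [1 - e] bring the threshold from [Delta] down to
    [e / n * Delta]. *)
Definition passes n e : nat := `|Num.ceil (ln (n%:R / e) / e)|%N.

Lemma ratio_ge1 n e : 0 < e <= 1 -> (0 < n)%N -> 1 <= n%:R / e.
Proof.
move=> /andP[e_gt0 e_le1] n_gt0; rewrite ler_pdivlMr // mul1r.
by apply: le_trans e_le1 _; rewrite ler1n.
Qed.

Lemma passes_enough n e : 0 < e <= 1 -> (0 < n)%N ->
  (1 - e) ^+ passes n e <= e / n%:R.
Proof.
move=> e01 n_gt0; have ne_ge1 := ratio_ge1 e01 n_gt0.
have /andP[e_gt0 e_le1] := e01.
have ne_gt0 : 0 < n%:R / e by apply: lt_le_trans ne_ge1.
have arg_ge0 : 0 <= ln (n%:R / e) / e by rewrite divr_ge0 ?ln_ge0 // ltW.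
have := absz_ceil_ge arg_ge0; rewrite -/(passes n e) ler_pdivrMr // => P_ge.
apply: (@le_trans _ _ (expR (- e) ^+ passes n e)).
  by rewrite lerXn2r ?nnegrE ?expR_ge0 ?subr_ge0 // expR_ge1Dx.
rewrite -expRM_natl -invf_div -[leRHS](lnK (_ : _ \in Num.pos)); last first.
  by rewrite posrE invr_gt0.
by rewrite ler_expR lnV ?posrE // mulrN lerN2.
Qed.

Lemma ln_ge_half h : 2 <= h -> 1 / 2 <= ln h.
Proof.
move=> h_ge2; apply: le_trans ln2_ge_half _.
by rewrite ler_ln ?posrE // (lt_le_trans _ h_ge2).
Qed.

Lemma passes_le n e h : 0 < e <= 1 / 2 -> (0 < n)%N -> 2 <= h ->
  n%:R / e <= h -> (passes n e)%:R * e <= 2 * ln h.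
Proof.
move=> /andP[e_gt0 e_le] n_gt0 h_ge2 ne_le.
have e01 : 0 < e <= 1 by rewrite e_gt0; lra.
have ne_ge1 := ratio_ge1 e01 n_gt0.
have arg_ge0 : 0 <= ln (n%:R / e) / e by rewrite divr_ge0 ?ln_ge0 // ltW.
have := absz_ceil_lt arg_ge0; rewrite -/(passes n e) => P_lt.
have lnh := ln_ge_half h_ge2.
have lnne : ln (n%:R / e) <= ln h.
  by rewrite ler_ln ?posrE //; [exact: lt_le_trans ne_ge1 | exact: lt_le_trans h_ge2].
have : (passes n e)%:R * e <= (ln (n%:R / e) / e + 1) * e.
  by rewrite ler_wpM2r // ltW.
by rewrite mulrDl divfK ?gt_eqF // mul1r; lra.
Qed.

Lemma ku_le (T : finType) e h : 0 < e <= 1 / 2 -> (0 < #|T|)%N -> 2 <= h ->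
  #|T|%:R / e <= h -> (ku T e)%:R <= 3 * h.
Proof.
move=> /andP[e_gt0 e_le] n_gt0 h_ge2 ne_le.
have n_ge1 : 1 <= #|T|%:R :> R by rewrite ler1n.
have ln2_gt0 : 0 < ln 2 :> R by rewrite ln_gt0 // ltr1n.
have arg_ge0 : 0 <= e^-1 * log2 #|T|%:R :> R.
  apply: mulr_ge0; first by rewrite invr_ge0 ltW.
  by apply: divr_ge0; [exact: ln_ge0 | exact: ltW].
have := absz_ceil_lt arg_ge0; rewrite -/(ku T e) => ku_lt.
suff : e^-1 * log2 #|T|%:R <= 2 * h by lra.
have log_le : log2 #|T|%:R <= 2 * #|T|%:R :> R.
  rewrite ler_pdivrMr //.
  have := @ln_sublinear R #|T|%:R; have := ln2_ge_half.
  have := ler_wpM2l (ler0n R #|T|) ln2_ge_half.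
  by rewrite ltr0n n_gt0 => ? ? /(_ isT); lra.
apply: (@le_trans _ _ (e^-1 * (2 * #|T|%:R))).
  by rewrite ler_wpM2l // invr_ge0 ltW.
by rewrite mulrCA ler_wpM2l // mulrC.
Qed.

Lemma up_log_le (K : nat) h : 2 <= h -> K%:R <= 3 * h ->
  (up_log 2 K)%:R <= 8 * ln h.
Proof.
move=> h_ge2 K_le; have lnh := ln_ge_half h_ge2.
have h_gt0 : 0 < h by apply: lt_le_trans h_ge2.
have [K_le1|K_gt1] := leqP K 1.
  have -> : up_log 2 K = 0%N by apply/eqP; rewrite up_log_eq0 K_le1 orbT.
  by lra.
have := up_log_gtn (isT : 1 < 2)%N K_gt1.
have : (0 < up_log 2 K)%N by rewrite up_log_gt0.
case: (up_log 2 K) => // L _ /= L_lt.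
(* With [L + 1] the rounded-up logarithm, [2 ^ L < K <= 3 * h <= h ^ 3], so [L <= 6 * ln h] because
   [ln 2 >= 1 / 2]; the remaining [1] is at most [2 * ln h]. *)
have : 2 ^+ L <= h ^+ 3 :> R.
  apply: (@le_trans _ _ K%:R); first by rewrite -natrX ler_nat ltnW.
  by apply: le_trans K_le _; nra.
rewrite -ler_ln ?posrE ?exprn_gt0 // !lnXn // -[ln 2 *+ L]mulr_natl => ln_le.
have : L%:R * (1 / 2) <= L%:R * ln 2 :> R by rewrite ler_wpM2l ?ler0n ?ln2_ge_half.
by rewrite -[L.+1%:R]natr1; move: ln_le; rewrite -[ln h *+ 3]mulr_natl; lra.
Qed.

End Logarithms.

(** * Closed-form cost estimates *)

Section Costs.
Variable R : realFieldType.
Implicit Types n l P L h lam m K : R.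

(** Here [lam] is [ln h], [P] bounds the passes and [L] the search rounds. Each of the [L + 1] runs
    costs [q], of order [lam * h]; lower-order terms are absorbed by [h <= 2 * (lam * h)] and
    [lam <= lam * h]. *)
Lemma calls_le n l P L h lam :
  0 <= n -> 0 <= l -> 0 <= P -> 0 <= L ->
  n <= h -> l <= 2 * h -> P * (n * l) <= 4 * lam * h -> L <= 8 * lam ->
  1 / 2 <= lam -> 2 <= h ->
  n + (L * (n + (P * (n * l * 3) + 2 * (l + n)))
       + (n + (P * (n * l * 3) + 2 * (l + n)) + 2 * (L + 1)))
    <= 1000 * h * lam ^+ 2.
Proof.
move=> n0 l0 P0 L0 nh lh Ple Lle lam_ge h_ge.
have h0 : 0 <= h by lra.
have lam0 : 0 <= lam by lra.
have hl : h <= 2 * (lam * h) by nra.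
have ll : lam <= lam * h by nra.
have lll : lam * h <= 2 * (lam ^+ 2 * h) by rewrite expr2; nra.
set q := n + (P * (n * l * 3) + 2 * (l + n)).
have q_le : q <= 26 * (lam * h).
  by rewrite /q; lra.
have q0 : 0 <= q by rewrite /q !addr_ge0 ?mulr_ge0 // addr_ge0.
have Lq : L * q <= 8 * lam * (26 * (lam * h)) by apply: ler_pM.
have -> : 1000 * h * lam ^+ 2 = 1000 * (lam ^+ 2 * h) by ring.
have E : 8 * lam * (26 * (lam * h)) = 208 * (lam ^+ 2 * h) by ring.
move: Lq; rewrite {}E; lra.
Qed.

(** [t] is the cost of one run and [K] the initial upper end of the search, which enters linearly
    because a power is charged by its exponent. *)
Lemma ops_le n l P L K m h lam t :
  0 <= n -> 0 <= l -> 0 <= P -> 0 <= L -> 0 <= K -> 1 <= m -> 1 <= n * l ->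
  n <= h -> l <= 2 * h -> P * (n * l * m) <= 4 * lam * h -> L <= 8 * lam ->
  K <= 3 * h -> 1 / 2 <= lam -> 2 <= h ->
  t = n + (P * (3 + (n * l * (3 * m + 4) + 2)) + 3 + (l + n)) ->
  n + (3 + (L * (2 + (2 + (K + 3 + t))) + 2 + (K + 4 + (t + (L + 1)))))
    <= 1000 * h * lam ^+ 2.
Proof.
move=> n0 l0 P0 L0 K0 m1 nl1 nh lh Ple Lle Kle lam_ge h_ge tE.
have h0 : 0 <= h by lra.
have lam0 : 0 <= lam by lra.
have m0 : 0 <= m by lra.
have hl : h <= 2 * (lam * h) by nra.
have ll : lam <= lam * h by nra.
have lll : lam * h <= 2 * (lam ^+ 2 * h) by rewrite expr2; nra.
have nlm : n * l <= n * l * m by rewrite ler_peMr // mulr_ge0.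
have Pt : P * (3 + (n * l * (3 * m + 4) + 2)) <= 12 * (P * (n * l * m)).
  have -> : 12 * (P * (n * l * m)) = P * (12 * (n * l * m)) by ring.
  rewrite ler_wpM2l //.
  have -> : n * l * (3 * m + 4) = 3 * (n * l * m) + 4 * (n * l) by ring.
  lra.
have t_le : t <= 62 * (lam * h).
  by move: Pt; rewrite tE; set X := P * (3 + _); lra.
have t0 : 0 <= t.
  by rewrite tE !(addr_ge0, mulr_ge0).
have Lt : L * (2 + (2 + (K + 3 + t))) <= 8 * lam * (82 * (lam * h)).
  apply: ler_pM => //; last by lra.
  by lra.
have E : 8 * lam * (82 * (lam * h)) = 656 * (lam ^+ 2 * h) by ring.
have -> : 1000 * h * lam ^+ 2 = 1000 * (lam ^+ 2 * h) by ring.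
move: Lt; rewrite {}E; set X := L * _; lra.
Qed.

End Costs.

(** * From the surviving fraction to the approximation guarantee *)

Section Survives.
Variables (R : realType) (T : finType) (f : {set T} -> R) (l : nat).
Hypothesis l_gt0 : (0 < l)%N.

Lemma survives_submodular (O : {set T}) :
  submodular f -> nonnegative f -> survives f l (1 - l%:R^-1) O.
Proof.
move=> f_sub f_ge0 F F_disj.
rewrite mulrBl mul1r mulVf ?pnatr_eq0 -?lt0n //.
have := sum_union_disjoint f_sub f_ge0 O (enum_uniq 'I_l)
  (fun i j _ _ => @F_disj i j).
by rewrite size_enum_ord big_enum.
Qed.

Lemma survives_monotone (O : {set T}) : monotone f -> survives f l 1 O.
Proof.
move=> f_mono F _; rewrite mul1r.
have -> : l%:R * f O = \sum_(j < l) f O.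
  by rewrite big_const_ord iter_addr_0 mulr_natl.
by apply: ler_sum => j _; apply: f_mono; exact: subsetUl.
Qed.

End Survives.

Definition run_calls (n l P L : nat) : nat :=
  let q := (n + (P * (n * l * 3) + 2 * (l + n)))%N in
  (n + (L * q + (q + 2 * L.+1)))%N.

Definition run_ops (n l P L K m : nat) : nat :=
  let t := (n + (P * (3 + (n * l * (3 * m + 4) + 2)) + 3 + (l + n)))%N in
  (n + (3 + (L * (2 + (2 + (K + 3 + t))) + 2 + (K + 4 + (t + L.+1)))))%N.

Lemma le_div_of_scaled (R : realFieldType) (b e alpha x y : R) :
  0 <= e -> 0 < alpha -> 1 + e <= alpha * b -> 0 <= x ->
  b * x <= (1 + e) * y -> x / alpha <= y.
Proof.
move=> e_ge0 alpha_gt0 alpha_b x_ge0 bx; rewrite ler_pdivrMr //.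
have e1_gt0 : 0 < 1 + e by rewrite ltr_wpDr.
rewrite -(ler_pM2l e1_gt0); apply: le_trans (ler_wpM2r x_ge0 alpha_b) _.
by rewrite -[leLHS]mulrA (mulrC y) [leRHS]mulrCA ler_pM2l.
Qed.

(** Serves both statements: [a] is the surviving fraction, [1 - 1 / l] or [1], and [A] is
    instantiated with [a - eps]. The hypothesis on [alpha] absorbs the factor [1 + eps] lost to the
    grid of densities. *)
Lemma DensitySearchSGS_approx (R : realType) (T : finType) (f : {set T} -> R)
    (I : {set {set T}}) (m k l p : nat) (c : 'I_m -> T -> R)
    (eps beta a A alpha : R) (orders : nat -> nat -> seq (T * 'I_l)) :
  instance k f I c -> 0 < eps < 1 / 2 -> (0 < l)%N -> (k <= p)%N ->
  (l.-1 <= p)%N -> valid_orders orders ->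
  beta = 2 * (1 - eps) * (A / (p%:R + 1 + 2 * m%:R)) ->
  0 <= A <= 1 -> A <= a -> (forall O, survives f l a O) ->
  0 < alpha -> 1 + eps <= alpha * (beta / 2) ->
  exists (fuel : nat) (S : {set T}) (calls ops : nat),
    [/\ DensitySearchSGS f I c orders fuel eps eps beta
          = Some (S, (calls, ops)),
        (calls <= run_calls #|T| l (passes #|T| eps) (up_log 2 (ku T eps)))%N,
        (ops <= run_ops #|T| l (passes #|T| eps) (up_log 2 (ku T eps))
                  (ku T eps) m)%N,
        feasible I c S & approx_ratio_le f I c alpha S].
Proof.
move=> inst /andP[eps_gt0 eps_lt] l_gt0 k_le_p l_le_p orders_valid betaE.
move=> /andP[A_ge0 A_le1] A_le surv alpha_gt0 alpha_b.
have eps_lt1 : eps < 1 by apply: lt_le_trans eps_lt _; lra.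
have e1_ge0 : 0 <= 1 - eps by rewrite subr_ge0 ltW.
have q_ge1 : 1 <= p%:R + 1 + 2 * m%:R :> R.
  by rewrite -addrA addrCA lerDl addr_ge0 ?mulr_ge0 ?ler0n.
have q_gt0 : 0 < p%:R + 1 + 2 * m%:R :> R by apply: lt_le_trans q_ge1.
have Aq : A / (p%:R + 1 + 2 * m%:R) <= 1.
  by rewrite ler_pdivrMr // mul1r (le_trans A_le1).
have Aq_ge0 : 0 <= A / (p%:R + 1 + 2 * m%:R) by rewrite divr_ge0 // ltW.
have beta_ge0 : 0 <= beta by rewrite betaE mulr_ge0 // mulr_ge0.
have b_le1 : beta / 2 <= 1.
  rewrite betaE mulrAC [2 * _]mulrC mulfK ?pnatr_eq0 //.
  by rewrite mulr_ile1 // gerBl ltW.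
have eps01 : 0 < eps <= 1 by rewrite eps_gt0 ltW.
have n_gt0 := inst_ground inst.
set P := passes #|T| eps; set L := up_log 2 (ku T eps).
(* One fuel value serves both loops, the passes of a run and the rounds of the search. *)
have [|||S [q [t [run q_le t_le [S_fb S_val]]]]] :=
    @spec_DensitySearchSGS R T f I m k l p c eps beta inst eps_gt0 eps_lt1
      l_gt0 k_le_p l_le_p beta_ge0 orders orders_valid P (maxn P L).+1.
- exact: passes_enough.
- by rewrite ltnS leq_maxl.
- by rewrite ltnS leq_maxr.
have [S_feas S_0 S_Delta] := S_fb.
exists (maxn P L).+1, S, q, t; split=> //.
move=> OPT [OPT_feas OPT_max].
have OPT_ge0 := inst_ge0 inst OPT; have S_ge0 := inst_ge0 inst S.
(* An empty optimum is treated apart since [f set0] may exceed [n * Delta]; there [f set0 <= f S]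
   suffices, as [beta / 2 <= 1]. *)
have [OPT0|OPT_neq0] := eqVneq OPT set0.
  apply: (le_div_of_scaled (ltW eps_gt0) alpha_gt0 alpha_b OPT_ge0).
  apply: (@le_trans _ _ (f OPT)).
    by rewrite ler_piMl.
  by rewrite OPT0; apply: le_trans S_0 _; rewrite ler_peMl // lerDl ltW.
apply: (le_div_of_scaled (ltW eps_gt0) alpha_gt0 alpha_b OPT_ge0).
apply: (search_value_ratio inst eps_gt0 eps_lt1 beta_ge0 betaE A_ge0 A_le
  _ OPT_feas (surv OPT) _ _ S_val).
- exact: natr_le_expn_ku.
- by apply: delta_le => // u; apply: OPT_max; exact: inst_single inst u.
- apply: le_trans (le_sum_singletons (inst_sub inst) (inst_ge0 inst) OPT_neq0) _.
  apply: le_trans (ler_sum _ (fun u _ => singleton_le_delta f u)) _.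
  rewrite sumr_const -[leLHS]mulr_natl ler_wpM2r ?delta_ge0 //.
  by rewrite ler_nat max_card.
Qed.

(** * Costs in terms of the parameters *)

Section CostBounds.
Variables (R : realType) (T : finType) (M : nat) (e h : R).
Hypothesis e_gt0 : 0 < e.
Hypothesis e_lt : e < 1 / 2.
Hypothesis n_gt0 : (0 < #|T|)%N.
Hypothesis M_gt0 : (0 < M)%N.
Let n : R := #|T|%:R.
Hypothesis h_ge : M%:R * n / e <= h.

Let n_ge1 : 1 <= n. Proof. by rewrite ler1n. Qed.
Let M_ge1 : 1 <= M%:R :> R. Proof. by rewrite ler1n. Qed.
Let e_le : 0 < e <= 1 / 2. Proof. by rewrite e_gt0 ltW. Qed.

Let Mn_ge1 : 1 <= M%:R * n. Proof. by rewrite mulr_ege1. Qed.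

Let Mn_le : 2 * (M%:R * n) <= h.
Proof.
apply: le_trans h_ge; rewrite ler_pdivlMr // mulrAC ler_piMl //.
  by rewrite mulr_ge0 ?ler0n.
by move: e_lt; lra.
Qed.

Lemma cost_h_ge2 : 2 <= h.
Proof. by move: Mn_ge1 Mn_le; set x := M%:R * n; lra. Qed.

Lemma cost_n_le : n <= h.
Proof.
have : n <= M%:R * n by rewrite ler_peMl ?ler0n.
by move: Mn_ge1 Mn_le; set x := M%:R * n; lra.
Qed.

Lemma cost_l_le : M.+1%:R <= 2 * h.
Proof.
have : M%:R <= M%:R * n by rewrite ler_peMr ?ler0n.
by rewrite -[M.+1%:R]natr1; move: Mn_ge1 Mn_le; set x := M%:R * n; lra.
Qed.

Let ne_le : n / e <= h.
Proof.
apply: le_trans h_ge; apply: ler_wpM2r; first by rewrite invr_ge0 ltW.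
by rewrite ler_peMl ?ler0n.
Qed.

(** The right-hand side keeps [M%:R * n / e] instead of [h], so that multiplication by the number of
    knapsacks yields the bound for arithmetic operations. *)
Lemma cost_passes :
  (passes #|T| e)%:R * (n * M.+1%:R) <= 4 * ln h * (M%:R * n / e).
Proof.
have P_le := passes_le e_le n_gt0 cost_h_ge2 ne_le.
have l_le : n * M.+1%:R <= 2 * (M%:R * n).
  rewrite mulrC mulrA ler_wpM2r ?ler0n // -[M.+1%:R]natr1.
  by move: M_ge1; lra.
apply: (@le_trans _ _ ((passes #|T| e)%:R * (2 * (M%:R * n)))).
  by rewrite ler_wpM2l ?ler0n.
rewrite [leRHS]mulrA ler_pdivlMr //.
have := ler_wpM2r (mulr_ge0 (ler0n R M) (ler0n R #|T|)) P_le.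
rewrite -/n; set x := M%:R * n; lra.
Qed.

Lemma cost_ku : (ku T e)%:R <= 3 * h.
Proof. exact: ku_le e_le n_gt0 cost_h_ge2 ne_le. Qed.

Lemma cost_search : (up_log 2 (ku T e))%:R <= 8 * ln h.
Proof. exact: up_log_le cost_h_ge2 cost_ku. Qed.

End CostBounds.

Lemma run_calls_le (R : realType) (T : finType) (M : nat) (e : R) :
  0 < e < 1 / 2 -> (0 < #|T|)%N -> (0 < M)%N ->
  softO 1000 2 (M%:R * #|T|%:R / e)
    (run_calls #|T| M.+1 (passes #|T| e) (up_log 2 (ku T e))).
Proof.
move=> /andP[e_gt0 e_lt] n_gt0 M_gt0; rewrite /softO /run_calls.
set h := M%:R * #|T|%:R / e; have h_ge : M%:R * #|T|%:R / e <= h by [].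
have h_ge2 := cost_h_ge2 e_gt0 e_lt n_gt0 M_gt0 h_ge.
rewrite !(natrD, natrM) -[(up_log 2 _).+1%:R]natr1.
apply: calls_le; rewrite ?ler0n ?ln_ge_half //.
- exact: cost_n_le h_ge.
- exact: cost_l_le h_ge.
- exact: cost_passes h_ge.
- exact: cost_search h_ge.
Qed.

Lemma run_ops_le (R : realType) (T : finType) (M m : nat) (e : R) :
  0 < e < 1 / 2 -> (0 < #|T|)%N -> (0 < M)%N -> (0 < m)%N ->
  softO 1000 2 (M%:R * m%:R * #|T|%:R / e)
    (run_ops #|T| M.+1 (passes #|T| e) (up_log 2 (ku T e)) (ku T e) m).
Proof.
move=> /andP[e_gt0 e_lt] n_gt0 M_gt0 m_gt0; rewrite /softO /run_ops.
set h := M%:R * m%:R * #|T|%:R / e.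
have m_ge1 : 1 <= m%:R :> R by rewrite ler1n.
have hE : h = m%:R * (M%:R * #|T|%:R / e) by rewrite /h; ring.
have h_ge : M%:R * #|T|%:R / e <= h.
  by rewrite hE ler_peMl // divr_ge0 ?mulr_ge0 ?ler0n // ltW.
have h_ge2 := cost_h_ge2 e_gt0 e_lt n_gt0 M_gt0 h_ge.
rewrite !(natrD, natrM) -[(up_log 2 _).+1%:R]natr1.
apply: ops_le (erefl _); rewrite ?ler0n ?ln_ge_half //.
- by rewrite -natrM ler1n muln_gt0 n_gt0.
- exact: cost_n_le h_ge.
- exact: cost_l_le h_ge.
- rewrite [leLHS]mulrA [leLHS]mulrC.
  have := cost_passes e_gt0 e_lt n_gt0 M_gt0 h_ge.
  by move/(ler_wpM2l (ler0n R m))/le_trans; apply; rewrite mulrCA -hE.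
- exact: cost_search h_ge.
- exact: cost_ku h_ge.
Qed.

(** * Arithmetic of the approximation ratios *)

(** The left side is [M + (2 * m + 1) / M + 2 * m + 2], and [s] minimises [M + s ^+ 2 / M]. In the
    case [M <= s + 1], the first two terms are at most [s + 1] and [s]. *)
Lemma balance_le (R : rcfType) (M k m s : R) :
  0 < k -> 0 <= m -> s = Num.sqrt (2 * m + 1) -> s <= M ->
  M = k \/ M <= s + 1 ->
  (M + 1 + 2 * m) * ((M + 1) / M) <=
    Num.max (k + (2 * m + 1) / k) (1 + 2 * s) + 2 * m + 2.
Proof.
move=> k_gt0 m_ge0 sE s_le M_cases.
have s2 : s ^+ 2 = 2 * m + 1 by rewrite sE sqr_sqrtr //; lra.
have s_gt0 : 0 < s by rewrite sE sqrtr_gt0; lra.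
have M_gt0 : 0 < M by apply: lt_le_trans s_le.
have -> : (M + 1 + 2 * m) * ((M + 1) / M) = M + (2 * m + 1) / M + 2 * m + 2.
  by field; rewrite gt_eqF.
rewrite !lerD2r le_max; case: M_cases => [->|M_le]; first by rewrite lexx.
apply/orP; right.
have : (2 * m + 1) / M <= s.
  by rewrite ler_pdivrMr // -s2 expr2 ler_pM2l.
lra.
Qed.

Lemma param_M_ge (R : realType) (m k : nat) :
  Num.sqrt (2 * m%:R + 1) <= (param_M R m k)%:R :> R.
Proof.
rewrite [2 * _ + 1]addrC; apply: le_trans (absz_ceil_ge (sqrtr_ge0 _)) _.
by rewrite ler_nat leq_maxl.
Qed.

Lemma param_M_cases (R : realType) (m k : nat) :
  (param_M R m k)%:R = k%:R :> R \/
  (param_M R m k)%:R <= Num.sqrt (2 * m%:R + 1) + 1 :> R.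
Proof.
rewrite /param_M; case: leqP => _; [by left | right].
by rewrite [2 * _ + 1]addrC ltW // absz_ceil_lt // sqrtr_ge0.
Qed.

(** One factor [1 - 2 * e] pays for the [e] in the numerator, since [(M + 1) / M <= 2]; the other
    two cover the losses [1 + e] and [1 - e], as [(1 + e) * (1 - 2 * e) ^+ 2 <= 1 - e]. *)
Lemma ratio_submodular (R : realFieldType) (e M m Y : R) :
  0 < e < 1 / 2 -> 1 <= M -> 0 <= m ->
  (M + 1 + 2 * m) * ((M + 1) / M) <= Y ->
  1 + e <= (1 - 2 * e) ^- 3 * Y *
    (2 * (1 - e) * ((1 - (M + 1)^-1 - e) / (M + 1 + 2 * m)) / 2).
Proof.
move=> /andP[e_gt0 e_lt] M_ge1 m_ge0 Y_ge.
have M_gt0 : 0 < M by lra.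
have M1_gt0 : 0 < M + 1 by lra.
have q_gt0 : 0 < M + 1 + 2 * m by lra.
have e2_gt0 : 0 < 1 - 2 * e by lra.
set A := 1 - (M + 1)^-1 - e.
have A_ge : 1 - 2 * e <= A * ((M + 1) / M).
  have -> : A * ((M + 1) / M) = (M - e * (M + 1)) / M.
    by rewrite /A; field; rewrite !gt_eqF.
  by rewrite ler_pdivlMr //; nra.
have A_ge0 : 0 <= A.
  have -> : A = A * ((M + 1) / M) * (M / (M + 1)).
    by field; rewrite !gt_eqF.
  by rewrite mulr_ge0 ?divr_ge0 //; lra.
rewrite [leRHS]mulrC [_ ^- 3 * Y]mulrC [leRHS]mulrA ler_pdivlMr ?exprn_gt0 //.
set b := 2 * (1 - e) * _ / 2.
have bE : b * ((M + 1 + 2 * m) * ((M + 1) / M)) = (1 - e) * (A * ((M + 1) / M)).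
  by rewrite /b; field; rewrite !gt_eqF.
have b_ge0 : 0 <= b by rewrite /b !mulr_ge0 ?invr_ge0 //; lra.
apply: le_trans (ler_wpM2l b_ge0 Y_ge); rewrite bE.
have e1_ge0 : 0 <= 1 - e by lra.
apply: le_trans (ler_wpM2l e1_ge0 A_ge).
rewrite exprSr mulrA; apply: ler_wpM2r; first exact: ltW.
have -> : (1 + e) * (1 - 2 * e) ^+ 2 = 1 - e - 2 * e * (1 - 2 * e ^+ 2) by ring.
rewrite gerBl mulr_ge0 //; first by lra.
by rewrite expr2; nra.
Qed.

(** Everything cancels down to [1 + e <= (1 - e)^-1]. *)
Lemma ratio_monotone (R : realFieldType) (e k m : R) :
  0 < e < 1 / 2 -> 0 <= k -> 0 <= m ->
  1 + e <= (1 - e) ^- 3 * (k + 2 * m + 1) *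
    (2 * (1 - e) * ((1 - e) / (k + 1 + 2 * m)) / 2).
Proof.
move=> /andP[e_gt0 e_lt] k_ge0 m_ge0.
have e1_gt0 : 0 < 1 - e by lra.
have q_gt0 : 0 < k + 2 * m + 1 by lra.
have -> : k + 1 + 2 * m = k + 2 * m + 1 by ring.
have -> : (1 - e) ^- 3 * (k + 2 * m + 1) *
    (2 * (1 - e) * ((1 - e) / (k + 2 * m + 1)) / 2) = (1 - e)^-1.
  by field; rewrite !gt_eqF.
by rewrite -div1r ler_pdivlMr //; nra.
Qed.

Theorem theorem25 (R : realType) :
  (exists (C : R) (a : nat),
    forall (T : finType) (f : {set T} -> R) (I : {set {set T}})
      (m k : nat) (c : 'I_m -> T -> R) (eps delta : R),
    instance k f I c -> eps = delta -> 0 < eps < 1 / 2 ->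
    let n := #|T| in
    let M := param_M R m k in
    let l := M.+1 in
    let p := maxn k l.-1 in
    let beta := 2 * (1 - eps) * ((1 - l%:R^-1 - eps) / (p%:R + 1 + 2 * m%:R)) in
    forall orders : nat -> nat -> seq (T * 'I_l), valid_orders orders ->
    exists (fuel : nat) (S : {set T}) (calls ops : nat),
      [/\ DensitySearchSGS f I c orders fuel delta eps beta
            = Some (S, (calls, ops)),
          softO C a (M%:R * n%:R / eps) calls,
          ((0 < m)%N -> softO C a (M%:R * m%:R * n%:R / eps) ops),
          feasible I c S
        & approx_ratio_le f I c
            ((1 - 2 * eps) ^- 3 *
             (Num.max (k%:R + (2 * m%:R + 1) / k%:R)
                      (1 + 2 * Num.sqrt (2 * m%:R + 1))
              + 2 * m%:R + 2)) S])
  /\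
  (forall (T : finType) (f : {set T} -> R) (I : {set {set T}})
      (m k : nat) (c : 'I_m -> T -> R) (eps delta : R) (l : nat),
    instance k f I c -> monotone f -> eps = delta -> 0 < eps < 1 / 2 ->
    (0 < l <= k + 1)%N ->
    let p := maxn k l.-1 in
    let beta := 2 * (1 - eps) * ((1 - eps) / (p%:R + 1 + 2 * m%:R)) in
    forall orders : nat -> nat -> seq (T * 'I_l), valid_orders orders ->
    exists (fuel : nat) (S : {set T}) (calls ops : nat),
      [/\ DensitySearchSGS f I c orders fuel delta eps beta
            = Some (S, (calls, ops)),
          feasible I c S
        & approx_ratio_le f I c
            ((1 - eps) ^- 3 * (k%:R + 2 * m%:R + 1)) S]).
Proof.
split.
(* The exponent [2] counts one logarithm from the passes of a run and one from the rounds of the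
   search. *)
- exists 1000, 2%N => T f I m k c eps _ inst <- eps01 n M l p beta orders.
  move=> orders_valid; have /andP[eps_gt0 eps_lt] := eps01.
  have k_gt0 := inst_k inst.
  have k_le_M : (k <= M)%N by exact: leq_maxr.
  have M_gt0 : (0 < M)%N by exact: leq_trans k_le_M.
  have M_ge1 : 1 <= M%:R :> R by rewrite ler1n.
  have pE : p = M by apply/maxn_idPr.
  have lE : l%:R = M%:R + 1 :> R by rewrite natr1.
  (* [l >= 2] keeps [1 - l%:R^-1 - eps] non-negative for [eps < 1 / 2]. *)
  have l_inv : 0 <= (l%:R^-1 : R) <= 1 / 2.
    by rewrite invr_ge0 ler0n -div1r ler_pdivrMr ?ltr0n // lE; lra.
  set alpha := (X in approx_ratio_le _ _ _ X).
  have alpha_b : 1 + eps <= alpha * (beta / 2).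
    rewrite /alpha /beta pE lE; apply: ratio_submodular => //; rewrite ?ler0n //.
    apply: balance_le; rewrite ?ltr0n ?ler0n //; first exact: param_M_ge.
    exact: param_M_cases.
  have alpha_gt0 : 0 < alpha.
    rewrite mulr_gt0 ?invr_gt0 ?exprn_gt0 //; first by lra.
    rewrite ltr_wpDl // addr_ge0 ?mulr_ge0 ?ler0n // le_max.
    by apply/orP; right; rewrite addr_ge0 // mulr_ge0 // sqrtr_ge0.
  have A01 : 0 <= 1 - l%:R^-1 - eps <= 1 by move: l_inv => /andP[]; lra.
  have [||fuel [S [calls [ops [run calls_b ops_b S_feas S_ratio]]]]] :=
    @DensitySearchSGS_approx R T f I m k l p c eps beta (1 - l%:R^-1)
      (1 - l%:R^-1 - eps) alpha orders inst eps01 isT (leq_maxl _ _)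
      (leq_maxr _ _) orders_valid erefl A01 _ _ alpha_gt0 alpha_b.
  + by rewrite gerBl ltW.
  + by move=> O; exact: survives_submodular (inst_sub inst) (inst_ge0 inst).
  exists fuel, S, calls, ops; split=> // [|m_gt0].
  + apply: le_trans (run_calls_le eps01 (inst_ground inst) M_gt0).
    by rewrite ler_nat.
  + apply: le_trans (run_ops_le eps01 (inst_ground inst) M_gt0 m_gt0).
    by rewrite ler_nat.
- move=> T f I m k c eps _ l inst f_mono <- eps01 /andP[l_gt0 l_le] p beta.
  move=> orders orders_valid; have /andP[eps_gt0 eps_lt] := eps01.
  have pE : p = k by apply/maxn_idPl; rewrite -ltnS prednK // -addn1.
  set alpha := (X in approx_ratio_le _ _ _ X).
  have alpha_b : 1 + eps <= alpha * (beta / 2).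
    by rewrite /alpha /beta pE; apply: ratio_monotone; rewrite ?ler0n.
  have alpha_gt0 : 0 < alpha.
    rewrite mulr_gt0 ?invr_gt0 ?exprn_gt0 //; first by lra.
    by rewrite ltr_wpDl // addr_ge0 ?mulr_ge0 ?ler0n.
  have A01 : 0 <= 1 - eps <= 1 by lra.
  have [||fuel [S [calls [ops [run _ _ S_feas S_ratio]]]]] :=
    @DensitySearchSGS_approx R T f I m k l p c eps beta 1 (1 - eps) alpha orders
      inst eps01 l_gt0 (leq_maxl _ _) (leq_maxr _ _) orders_valid erefl
      A01 _ _ alpha_gt0 alpha_b.
  + by rewrite gerBl ltW.
  + by move=> O; exact: survives_monotone.
  by exists fuel, S, calls, ops.
Qed.
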